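(* Up to isomorphism, the graphs of the class $\mathcal{P}_{-3}$ are those of cardinality $\geq 12$ of the class $\mathcal{G}$; that is, a graph is isomorphic to an element of $\mathcal{P}_{-3}$ if and only if it is isomorphic to an element of $\mathcal{G}$ with at least $12$ vertices.
   Context: Graphs are finite, simple and undirected; $G[X]$ is the subgraph induced by $X$ and $G-X=G[V(G)\setminus X]$. A subset $I\subseteq V(G)$ is an interval of $G$ if every vertex outside $I$ is adjacent to all or to none of the vertices of $I$. The sets $\emptyset$, $V(G)$ and $\{x\}$ ($x\in V(G)$) are the trivial intervals. $G$ is indecomposable if all its intervals are trivial. For an indecomposable graph $G=(V,E)$, the indecomposability graph $\mathbb{I}(G)$ has vertex set $V$, and its edges are the pairs $\{x,y\}$ of distinct vertices such that $G-\{x,y\}$ is indecomposable. A graph $H$ is $X$-covered, for $X\subseteq V(H)$, if every edge of $H$ meets $X$. Let $\mathbb{N}_n=\{1,\dots,n\}$. $P_n$ is the graph on $\mathbb{N}_n$ in which $i\ne j$ are adjacent iff $|i-j|=1$ (it is indecomposable for $n\ge4$). $\mathcal{P}_{-3}$ is the set of indecomposable graphs $G$ with vertex set $\mathbb{N}_n$ for some $n\geq 12$ such that $\mathbb{I}(G)$ is $\{1,n-3\}$-covered and $G-\{n,n-1,n-2\}=P_{n-3}$. Notation. For a vertex $v$ and a set $Y$ of vertices not containing $v$, $v\sim Y$ means that $v$ is adjacent to all vertices of $Y$ or to none of them; $v\not\sim Y$ is the negation. For $G=(V,E)$ and $X\subseteq V$ with $|X|\geq 4$ and $G[X]$ indecomposable: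 $X^-$ is the set of $v\in V\setminus X$ adjacent to no vertex of $X$; for $u\in X$, $X(u)$ is the set of $v\in V\setminus X$ such that $\{u,v\}$ is an interval of $G[X\cup\{v\}]$. If $|V\setminus X|\ge2$, $G_X$ is the graph with vertex set $V\setminus X$ in which $x\neq y$ are adjacent iff $G[X\cup\{x,y\}]$ is indecomposable; $E(G_X)$ is its edge set. $\mathcal{G}$ is the class of graphs $G$ with vertex set $\mathbb{N}_n$, where $n\geq 12$, such that, with $X=\mathbb{N}_{n-3}$, $G[X]=P_{n-3}$, $n-2\in X^-$, and one and only one of the following assertions is satisfied: (i) $n-1\in X^-$, $X(1)=\{n\}$, $E(G_X)=\{\{n,n-1\}\}$ and $n-1$ is adjacent to $n-2$ in $G$. (ii) $X(2)=\{n-1\}$, $X(1)=\{n\}$, $|E(G_X)|\geq 2$, and $1$ is not adjacent to $n$ in $G$ if $\{n,n-1\}\in E(G_X)$. (iii) $X(u)=\{n-1,n\}$ where $u\in\{1,2\}$, and either $|E(G_X)|=2$ with $u\not\sim\{n-1,n\}$, or $E(G_X)=\{\{n,n-2\}\}$ with $n\not\sim\{n-1,u\}$. *)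

(* Defs.v *)
From mathcomp Require Import all_boot.

Set Implicit Arguments.
Unset Strict Implicit.
Unset Printing Implicit Defensive.

Record sgraph (V : finType) := SGraph {
  adj :> rel V;
  adj_sym : symmetric adj;
  adj_irr : irreflexive adj
}.

Definition isomorphic (V W : finType) (G : sgraph V) (H : sgraph W) : Prop :=
  exists2 f : V -> W, bijective f & forall x y, H (f x) (f y) = G x y.

Section Graphs.
Variables (V : finType) (G : sgraph V).
Implicit Types (v x y : V) (X Y I : {set V}).

(* v ~ Y *)
Definition sim v Y : bool :=
  [forall y in Y, G v y] || [forall y in Y, ~~ G v y].

Definition interval I : bool := [forall v, (v \notin I) ==> sim v I].

Definition trivial_set I : bool :=
  [|| I == set0, I == [set: V] | [exists x, I == [set x]]].

Definition indecomposable : bool :=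
  [forall I : {set V}, interval I ==> trivial_set I].

Definition covered X : Prop := forall x y, G x y -> (x \in X) || (y \in X).

End Graphs.

Section Induced.
Variables (V : finType) (G : sgraph V) (X : {set V}).

Definition induced_rel : rel {x : V | x \in X} := fun x y => G (val x) (val y).

Fact induced_sym : symmetric induced_rel.
Proof. by move=> x y; apply: adj_sym. Qed.

Fact induced_irr : irreflexive induced_rel.
Proof. by move=> x; apply: adj_irr. Qed.

Definition induced : sgraph {x : V | x \in X} := SGraph induced_sym induced_irr.

End Induced.

Definition delete (V : finType) (G : sgraph V) (X : {set V}) := induced G (~: X).

Section IndecomposabilityGraph.
Variables (V : finType) (G : sgraph V).

Definition indec_rel : rel V :=
  fun x y => (x != y) && indecomposable (delete G [set x; y]).

Fact indec_sym : symmetric indec_rel.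
Proof. by move=> x y; rewrite /indec_rel eq_sym setUC. Qed.

Fact indec_irr : irreflexive indec_rel.
Proof. by move=> x; rewrite /indec_rel eqxx. Qed.

Definition indec_graph : sgraph V := SGraph indec_sym indec_irr.

End IndecomposabilityGraph.

Section Partition.
Variables (V : finType) (G : sgraph V) (X : {set V}).

(* X^- *)
Definition isolated_from : {set V} :=
  [set v in ~: X | [forall x in X, ~~ G v x]].

(* X(u); the set {u, v} is read inside the vertex type of G[X :|: {v}] *)
Definition twins_of (u : V) : {set V} :=
  [set v in ~: X |
     interval (induced G (v |: X)) [set z | val z \in [set u; v]]].

(* E(G_X), its edges being unordered pairs of elements of V outside X *)
Definition outside_edges : {set {set V}} :=
  [set [set p.1; p.2] | p : V * V &
     [&& p.1 \in ~: X, p.2 \in ~: X, p.1 != p.2 &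
         indecomposable (induced G (X :|: [set p.1; p.2]))]].

End Partition.

(* The vertex set {1, .., n} is represented by 'I_n, with i : 'I_n standing
   for the label i.+1. *)

Definition path_rel n : rel 'I_n := fun i j => (i.+1 == j) || (j.+1 == i).

Fact path_sym n : symmetric (@path_rel n).
Proof. by move=> i j; rewrite /path_rel orbC. Qed.

Fact path_irr n : irreflexive (@path_rel n).
Proof. by move=> i; rewrite /path_rel orbb gtn_eqF. Qed.

Definition path_graph n : sgraph 'I_n := SGraph (@path_sym n) (@path_irr n).

Definition initial n m : {set 'I_n} := [set i : 'I_n | (i : nat) < m].

(* G[Y] = P_m as labelled graphs, not merely up to isomorphism: the two have
   the same set of labels and the same adjacency. *)
Definition induced_eq_path n (G : sgraph 'I_n) (Y : {set 'I_n}) m : Prop :=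
  Y = initial n m /\
  forall (x y : 'I_n) (i j : 'I_m),
    x = i :> nat -> y = j :> nat -> G x y = path_graph m i j.

(* The vertex with label k, for 1 <= k <= n (see vtxK); the value is irrelevant
   for other k. *)
Definition vtx n (n_ge12 : 12 <= n) (k : nat) : 'I_n :=
  insubd (Ordinal (leq_trans (ltn0Sn 11) n_ge12)) k.-1.

Fact vtxK n (n_ge12 : 12 <= n) k : 0 < k <= n -> (vtx n_ge12 k).+1 = k.
Proof. by case: k => // k /andP[_ lt_kn]; rewrite /vtx val_insubd lt_kn. Qed.

(* P_{-3} *)
Definition in_P3 n (G : sgraph 'I_n) : Prop :=
  exists n_ge12 : 12 <= n,
    let v := vtx n_ge12 in
    [/\ indecomposable G,
        covered (indec_graph G) [set v 1; v (n - 3)] &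
        induced_eq_path G (~: [set v n; v (n - 1); v (n - 2)]) (n - 3)].

Section ClassG.
Variables (n : nat) (n_ge12 : 12 <= n) (G : sgraph 'I_n).
Let v := vtx n_ge12.
Let X := initial n (n - 3).
Let E := outside_edges G X.

Definition assertion_i : Prop :=
  [/\ v (n - 1) \in isolated_from G X,
      twins_of G X (v 1) = [set v n],
      E = [set [set v n; v (n - 1)]] &
      G (v (n - 1)) (v (n - 2))].

Definition assertion_ii : Prop :=
  [/\ twins_of G X (v 2) = [set v (n - 1)],
      twins_of G X (v 1) = [set v n],
      2 <= #|E| &
      [set v n; v (n - 1)] \in E -> ~~ G (v 1) (v n)].

Definition assertion_iii : Prop :=
  exists u : 'I_n,
    [/\ u = v 1 \/ u = v 2,
        twins_of G X u = [set v (n - 1); v n] &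
        (#|E| = 2 /\ ~~ sim G u [set v (n - 1); v n]) \/
        (E = [set [set v n; v (n - 2)]] /\ ~~ sim G (v n) [set v (n - 1); u])].

End ClassG.

Definition exactly_one (A B C : Prop) : Prop :=
  [\/ [/\ A, ~ B & ~ C], [/\ ~ A, B & ~ C] | [/\ ~ A, ~ B & C]].

Definition in_G n (G : sgraph 'I_n) : Prop :=
  exists n_ge12 : 12 <= n,
    let X := initial n (n - 3) in
    [/\ induced_eq_path G X (n - 3),
        vtx n_ge12 (n - 2) \in isolated_from G X &
        exactly_one (assertion_i n_ge12 G) (assertion_ii n_ge12 G)
                    (assertion_iii n_ge12 G)].

(* Main.v *)
(** Fix a graph of P_{-3}. Deleting two of the three vertices outside the path must destroy
indecomposability, so every outer vertex is joined to all or to none of the path, or is a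
twin of a path vertex u. An outer vertex that is a twin of an inner path vertex can be exchanged
with it: the result is another member of P_{-3}, whose outer vertices are again typed. Together with
the deletion of a few well-chosen pairs, this leaves very few possibilities for two outer vertices
to be adjacent in an unexpected way, i.e. in a way which makes their union with the path
indecomposable. Such a pair exists because the whole graph is indecomposable; up to an exchange
and the reversal of the path it consists of a vertex joined to nothing on the path and a twin of
vertex 1 or 2 adjacent to it, and the type of the third vertex then yields (i), (ii) or (iii).
Conversely, in those three cases deleting a path vertex with label at least 3 cuts off the tail of
the path, and the few remaining deletions create an isolated vertex, twins or a cut. *)

(* The obstacle is the two ends of the path. The covering hypothesis says nothing about deletions
   that contain an end, so exchanging an end with one of its twins would lose control of that twin's
   old label. Exchanges therefore settle only pairs involving a twin of an inner vertex;
   combinations of end twins and constant vertices need explicit deletions whose remainder is shown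
   indecomposable. Such a remainder contains an induced path, to which the missing vertices are
   added one by one, each being neither constant on what is already there nor a twin of one of its
   vertices. Exchanges and the reversal change the labelling, which is why the result holds up to
   isomorphism. The bound n >= 12 gives a path of at least nine vertices, so that exceptions near
   one end never meet exceptions near the other. Vertices are natural numbers and subgraphs are
   predicates on them: all deletions then share one adjacency relation, and the local checks become
   arithmetic. *)
Require Import Defs.
From mathcomp Require Import all_boot zify.
From Stdlib Require Import Classical.

Set Implicit Arguments.
Unset Strict Implicit.
Unset Printing Implicit Defensive.

(* Atoms of adjacency variables slow lia down; clear the hypotheses about them. *)
Ltac alia := repeat match goal with H : context [?g _ _] |- _ => is_var g; clear H end; lia.

(** * Indecomposable induced subgraphs *)

(* The induced subgraph on Y is indecomposable. *)
Definition primeOn (g : rel nat) (Y : pred nat) : Prop :=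
  forall I : pred nat,
    (forall i, I i -> Y i) ->
    (forall v i j, Y v -> ~~ I v -> I i -> I j -> g v i = g v j) ->
    (forall i j, I i -> I j -> i = j) \/ (forall i, Y i -> I i).

Lemma eq_primeOn g g' (Y Y' : pred nat) :
  (forall i j, Y i -> Y j -> g i j = g' i j) -> Y =1 Y' ->
  primeOn g Y -> primeOn g' Y'.
Proof.
move=> eg eY pY I sIY iI.
have sI i : I i -> Y i by move=> /sIY; rewrite eY.
case: (pY I sI) => [v i j Yv nIv Ii Ij|?|aI]; [|by left|by right=> i; rewrite -eY; apply: aI].
by rewrite (eg v i Yv (sI _ Ii)) (eg v j Yv (sI _ Ij)); apply: iI; rewrite -?eY.
Qed.

(** The preimage of an interval under [p] is again an interval. This transports indecomposability
    along relabellings and along enumerations of a path. *)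
Lemma primeOn_comp g (Y Z : pred nat) (p : nat -> nat) :
  (forall i, Z i -> Y (p i)) -> (forall t, Y t -> exists2 i, Z i & p i = t) ->
  primeOn (fun i j => g (p i) (p j)) Z -> primeOn g Y.
Proof.
move=> pY pS pr I sIY iI.
case: (pr (fun i => Z i && I (p i))) => [i /andP[]//|v i j Zv|sg|al].
- by rewrite Zv /= => nI /andP[_ Ii] /andP[_ Ij]; apply: iI => //; apply: pY.
- left=> i j Ii Ij; case: (pS i (sIY _ Ii)) => i' Zi' ei.
  case: (pS j (sIY _ Ij)) => j' Zj' ej.
  by rewrite -ei -ej (sg i' j') ?Zi' ?Zj' ?ei ?ej.
- by right=> t /pS[i Zi <-]; case/andP: (al i Zi).
Qed.

(** An interval of Z meets Y in an interval of Y, hence in all of Y, in one vertex or in none; each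
    case is trivial, makes [v] constant on Y, or makes [v] a twin of some [u] in Y. The two
    exclusions are stated as refutations, so that each use amounts to evaluating adjacencies at a
    few chosen vertices. *)
Lemma primeOn_ext g (Y Z : pred nat) v :
  symmetric g -> primeOn g Y -> ~~ Y v ->
  (forall i, Z i = Y i || (i == v)) ->
  (forall b, (forall i, Y i -> g v i = b) -> False) ->
  (forall u, Y u -> (forall w, Y w -> w <> u -> g v w = g u w) -> False) ->
  primeOn g Z.
Proof.
move=> sg pY nYv eZ nc nt I sIZ iI.
have YZ i : Y i -> Z i by rewrite eZ => ->.
have Zv : Z v by rewrite eZ eqxx orbT.
have IE i : I i -> Y i || (i == v) by move=> /sIZ; rewrite eZ.
case: (pY (fun i => Y i && I i)) => [i /andP[]//|w i j Yw|sI|aI].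
- rewrite Yw /= => nIw /andP[_ Ii] /andP[_ Ij].
  by apply: iI => //; apply: YZ.
- case: (classic (exists u, Y u && I u)) => [[u /andP[Yu Iu]]|nI].
  + have [Iv|nIv] := boolP (I v).
    * case: (nt u Yu) => w Yw wu; have nIw : ~~ I w.
        by apply/negP => Iw; apply: wu; apply: sI; apply/andP.
      by rewrite sg [RHS]sg; apply: iI => //; apply: YZ.
    * left=> i j Ii Ij; apply: sI; rewrite ?Ii ?Ij andbT.
        by case/orP: (IE _ Ii) => // /eqP e; rewrite e (negbTE nIv) in Ii.
      by case/orP: (IE _ Ij) => // /eqP e; rewrite e (negbTE nIv) in Ij.
  + left=> i j Ii Ij.
    have vE k : I k -> k = v.
      move=> Ik; case/orP: (IE _ Ik) => [Yk|/eqP//].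
      by case: nI; exists k; rewrite Yk.
    by rewrite (vE i Ii) (vE j Ij).
- have [Iv|nIv] := boolP (I v).
    by right=> i; rewrite eZ => /orP[/aI/andP[]//|/eqP->].
  case: (classic (exists u, Y u)) => [[u Yu]|nY].
    case: (nc (g v u)) => i Yi; apply: iI => //; first by case/andP: (aI i Yi).
    by case/andP: (aI u Yu).
  left=> i j Ii; case/orP: (IE _ Ii) => [Yi|/eqP e]; first by case: nY; exists i.
  by rewrite e (negbTE nIv) in Ii.
Qed.

Definition pth i j := (i.+1 == j) || (j.+1 == i).

Lemma pthC i j : pth i j = pth j i. Proof. by rewrite /pth orbC. Qed.

(** Induction from P_4. The new end [k] is separated from k - 1 by k - 2; any other twin of [k]
    would be adjacent to k - 1, hence equal to k - 2, and k - 3 separates that one. *)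
Lemma pth_prime k : 4 <= k -> primeOn pth (fun i => i < k).
Proof.
elim: k => // k IH; rewrite leq_eqVlt => /orP[/eqP <-|k4].
  move=> I sI iI.
  have h v i j : v < 4 -> ~~ I v -> I i -> I j -> pth v i = pth v j := iI v i j.
  have {iI h}[h|h] : [/\ I 0, I 1, I 2 & I 3] \/ (I 0 + I 1 + I 2 + I 3 <= 1).
    move: (h 0 1 2 isT) (h 0 1 3 isT) (h 1 0 3 isT) (h 1 2 3 isT) (h 2 0 1 isT)
      (h 2 0 3 isT) (h 3 0 2 isT) (h 3 1 2 isT); rewrite /pth /=.
    case: (I 0); case: (I 1); case: (I 2); case: (I 3) => /=; intros;
      (try by right); (try by left); exfalso; auto;
      match goal with H : _ |- _ => by have := H isT isT isT end.
    by right=> i; case: h => ????; case: i => [|[|[|[|]]]].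
  left=> i j Ii Ij; move: (sI _ Ii) (sI _ Ij) h.
  case: i Ii => [|[|[|[|//]]]] Ii; case: j Ij => [|[|[|[|//]]]] Ij //= _ _; lia.
apply: (primeOn_ext (v := k) _ (IH k4)).
- exact: pthC.
- by rewrite ltnn.
- by move=> i; rewrite ltnS leq_eqVlt orbC.
- case: k k4 {IH} => [|k] // k4 b h; have := h 0; have := h k; rewrite /pth; lia.
- case: k k4 {IH} => [|[|[|k]]] // k4 u uk h.
  by have := h k.+2; have := h k.+1; have := h k; rewrite /pth; lia.
Qed.

(* The subgraph induced on Y is a path with k vertices, one end of which is h. *)
Definition path_set (g : rel nat) (h k : nat) (Y : pred nat) : Prop :=
  exists p : nat -> nat,
    [/\ p 0 = h,
        forall i j, i < k -> j < k -> p i = p j -> i = j,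
        forall i, i < k -> Y (p i),
        forall t, Y t -> exists2 i, i < k & p i = t &
        forall i j, i < k -> j < k -> g (p i) (p j) = pth i j].

Lemma path_set_prime g h k Y : 4 <= k -> path_set g h k Y -> primeOn g Y.
Proof.
move=> k4 [p [_ _ pY pS gp]]; apply: (primeOn_comp pY pS).
by apply: (eq_primeOn _ _ (pth_prime k4)) => // i j ik jk; rewrite gp.
Qed.

Lemma path_set_cons g h k (Y Z : pred nat) a :
  symmetric g -> irreflexive g -> path_set g h k Y -> 0 < k -> ~~ Y a ->
  (forall i, Z i = Y i || (i == a)) -> (forall i, Y i -> g a i = (i == h)) ->
  path_set g a k.+1 Z.
Proof.
move=> sg ig [p [p0 pI pY pS gp]] k0 nYa eZ ga.
have aE i : i < k -> g a (p i) = (i == 0).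
  move=> ik; rewrite ga ?pY // -p0; apply/eqP/eqP => [/pI->//|->//].
have na i : i < k -> p i <> a by move=> /pY Yi e; rewrite e (negbTE nYa) in Yi.
exists (fun i => if i is j.+1 then p j else a); split=> //.
- move=> [|i] [|j] //= ik jk; first by move/esym/na; case.
    by move/na; case.
  by move/pI->.
- by move=> [|i] ik; rewrite eZ ?eqxx ?orbT ?pY.
- move=> t; rewrite eZ => /orP[/pS[i ik <-]|/eqP->]; first by exists i.+1.
  by exists 0.
- move=> [|i] [|j] //= ik jk.
  + by rewrite aE // /pth; case: j jk.
  + by rewrite sg aE // /pth; case: i ik.
  + by rewrite gp.
Qed.

Lemma path_set_up g s k (Y : pred nat) :
  (forall i j, Y i -> Y j -> g i j = pth i j) ->
  (forall i, Y i = (s <= i < s + k)) -> path_set g s k Y.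
Proof.
move=> pg eY; exists (fun i => s + i); split; rewrite ?addn0 //.
- by move=> i j _ _ /addnI.
- by move=> i ik; rewrite eY; lia.
- by move=> t; rewrite eY => h; exists (t - s); lia.
- by move=> i j ik jk; rewrite pg ?eY /pth; lia.
Qed.

Lemma path_set_down g s k (Y : pred nat) :
  (forall i j, Y i -> Y j -> g i j = pth i j) ->
  (forall i, Y i = (s < i + k) && (i <= s)) -> k <= s.+1 -> path_set g s k Y.
Proof.
move=> pg eY ks; exists (fun i => s - i); split; rewrite ?subn0 //.
- by move=> i j; lia.
- by move=> i ik; rewrite eY; lia.
- by move=> t; rewrite eY => h; exists (s - t); lia.
- by move=> i j ik jk; rewrite pg ?eY /pth; lia.
Qed.

(** * Outer vertices and exchanges *)

(* Labels start at 0 and the graph has q + 12 vertices: the path is 0, .., q + 8 and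
   the three remaining vertices are q + 9, q + 10 and q + 11. *)
Definition outer q z := q + 9 <= z < q + 12.

(* z is a twin of u over the path: z lies in X(u). *)
Definition tw q (g : rel nat) u z : Prop :=
  forall i, i < q + 9 -> i <> u -> g z i = pth u i.

(** For [b = false] this is membership in X^-; for [b = true], [z] is joined to the whole path. *)
Definition const_on q (g : rel nat) b z : Prop :=
  forall i, i < q + 9 -> g z i = b.

(** The covering condition contraposed: with labels starting at 0, the exempt vertices 1 and n - 3
    are 0 and q + 8. *)
Definition critical q (g : rel nat) : Prop := forall x y,
  x < q + 12 -> y < q + 12 -> x <> y ->
  x <> 0 -> x <> q + 8 -> y <> 0 -> y <> q + 8 ->
  ~ primeOn g (fun i => [&& i < q + 12, i != x & i != y]).

Record frame q (g : rel nat) : Prop := Frame {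
  fr_sym : symmetric g;
  fr_irr : irreflexive g;
  fr_path : forall i j, i < q + 9 -> j < q + 9 -> g i j = pth i j;
  fr_prime : primeOn g (fun i => i < q + 12);
  fr_crit : critical q g
}.

Definition relabel (s : nat -> nat) (g : rel nat) : rel nat :=
  fun i j => g (s i) (s j).

(** Since [s] sends no inner or outer vertex to an end, a pair avoiding both ends is mapped to a
    pair avoiding both ends, and criticality is inherited. *)
Lemma relabel_frame q g s : frame q g -> involutive s ->
  (forall i, (s i < q + 12) = (i < q + 12)) ->
  (forall i, s i = 0 \/ s i = q + 8 -> i = 0 \/ i = q + 8) ->
  (forall i j, i < q + 9 -> j < q + 9 -> relabel s g i j = pth i j) ->
  frame q (relabel s g).
Proof.
move=> [sg ig pg prg cg] si sn se sp; split=> //.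
- by move=> i j; apply: sg.
- by move=> i; apply: ig.
- apply: (@primeOn_comp (relabel s g) _ (fun i => i < q + 12) s) => [i|t tn|].
  + by rewrite sn.
  + by exists (s t); rewrite ?sn ?si.
  + by apply: (eq_primeOn _ _ prg) => // i j _ _; rewrite /relabel !si.
- move=> x y xn yn xy x0 x8 y0 y8 prs; apply: (cg (s x) (s y)); rewrite ?sn //.
  + by move/(can_inj si).
  + by move=> e; case: (se x); [left|apply: x0|apply: x8].
  + by move=> e; case: (se x); [right|apply: x0|apply: x8].
  + by move=> e; case: (se y); [left|apply: y0|apply: y8].
  + by move=> e; case: (se y); [right|apply: y0|apply: y8].
  apply: (@primeOn_comp g _ [pred i | [&& i < q + 12, i != x & i != y]] s) => //.
  + by move=> i /= /and3P[i1 i2 i3]; rewrite sn i1 !(inj_eq (can_inj si)) i2.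
  + move=> t /and3P[i1 i2 i3]; exists (s t); rewrite //= sn i1 /=.
    by rewrite -(inj_eq (can_inj si)) si i2 -(inj_eq (can_inj si)) si.
Qed.

Lemma init_prime q (g : rel nat) :
  (forall i j, i < q + 9 -> j < q + 9 -> g i j = pth i j) ->
  primeOn g (fun i => i < q + 9).
Proof.
move=> pg; have k4 : 4 <= q + 9 by lia.
by apply: (eq_primeOn _ _ (pth_prime k4)) => // i j i1 j1; rewrite pg.
Qed.

Lemma typed q g z : frame q g -> outer q z ->
  (exists b, const_on q g b z) \/ (exists2 u, u < q + 9 & tw q g u z).
Proof.
move=> fr /andP[z1 z2]; apply: NNPP => nt.
have [x [y [xy xo yo xz yz]]] : exists x y, [/\ x <> y, outer q x, outer q y, x <> z & y <> z].
  rewrite /outer; case: (ltngtP z (q+10)) => h;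
  [exists (q+10), (q+11)|exists (q+9), (q+10)|exists (q+9), (q+11)]; split; lia.
move: xo yo => /andP[x1 x2] /andP[y1 y2].
apply: (@fr_crit _ _ fr x y); try lia.
apply: (@primeOn_ext g (fun i => i < q + 9) _ z); last 1 first.
- move=> u ui h; apply: nt; right; exists u => // i im iu.
  by rewrite h // (fr_path fr).
- exact: fr_sym fr.
- exact: init_prime (fr_path fr).
- lia.
- by move=> i; lia.
- by move=> b h; apply: nt; left; exists b.
Qed.

Definition swap (u z i : nat) := if i == u then z else if i == z then u else i.

Lemma swapK u z : involutive (swap u z).
Proof.
move=> i; rewrite /swap; case: (eqVneq i u) => [->|iu].
  by rewrite eqxx; case: (eqVneq z u).
case: (eqVneq i z) => [->|iz]; first by rewrite eqxx.
by rewrite (negbTE iu) (negbTE iz).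
Qed.

(** As [u] is inner, the exchange fixes both ends; the twin condition lets [z] take the place of [u]
    on the path. *)
Lemma swap_frame q g u z : frame q g -> outer q z -> 0 < u < q + 8 ->
  tw q g u z -> frame q (relabel (swap u z) g).
Proof.
move=> fr /andP[z1 z2] /andP[u1 u2] tz; apply: (relabel_frame fr (swapK _ _)).
- by move=> i; rewrite /swap; case: eqP => [->|_]; [lia|case: eqP => [->|]; lia].
- by move=> i; rewrite /swap; case: eqP => [->|_]; [lia|case: eqP => [->|]; lia].
move=> i j im jm; rewrite /relabel /swap.
have zE k : k < q + 9 -> (k == z) = false by lia.
rewrite !zE //; case: (eqVneq i u) => [->|iu]; case: (eqVneq j u) => [->|ju].
- by rewrite (fr_irr fr) /pth; lia.
- by rewrite tz //; apply/eqP.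
- by rewrite (fr_sym fr) pthC tz //; apply/eqP.
- exact: (fr_path fr).
Qed.

Lemma swap_outer u z y : y <> u -> y <> z -> swap u z y = y.
Proof. by rewrite /swap => /eqP/negbTE-> /eqP/negbTE->. Qed.

(** This is [typed] after the exchange, read back in the original graph: position [u] of the path is
    now held by [z], so the type of [y] also governs the adjacency of [y] and [z]. The adjacency of
    [y] and [u] is left out, because [u] has become an outer vertex. *)
Lemma swap_typed q g u z y : frame q g -> outer q z -> 0 < u < q + 8 -> tw q g u z ->
  outer q y -> y <> z ->
  (exists b, g y z = b /\ forall i, i < q + 9 -> i <> u -> g y i = b) \/
  (exists2 v, v < q + 9 & (v <> u -> g y z = pth v u) /\
     forall i, i < q + 9 -> i <> u -> i <> v -> g y i = pth v i).
Proof.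
move=> fr oz ui tz oy yz.
have E i : i < q + 9 -> i <> u -> relabel (swap u z) g y i = g y i.
  move=> im iu; rewrite /relabel !swap_outer //; move: oz oy; rewrite /outer; lia.
have Eu : relabel (swap u z) g y u = g y z.
  rewrite /relabel swap_outer //; last by move: oy; rewrite /outer; lia.
  by rewrite /swap eqxx.
case: (typed (swap_frame fr oz ui tz) oy) => [[b h]|[v vm h]]; [left|right].
  exists b; split; first by rewrite -Eu h //; lia.
  by move=> i im iu; rewrite -E // h.
exists v => //; split=> [vu|i im iu iv]; last by rewrite -E // h.
by rewrite -Eu h //; [lia|move/esym].
Qed.

(** A twin of an inner [w] is adjacent on the path to w - 1, w + 1 and possibly [w] only. On at
    least nine vertices, omitting one leaves both a neighbour and a non-neighbour. *)
Lemma tw_nonconst q g w y u b : 0 < w < q + 8 -> tw q g w y ->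
  ~ (forall i, i < q + 9 -> i <> u -> g y i = b).
Proof.
case: w => [//|w] wi ty h.
have {}h i : i < q + 9 -> i <> u -> i <> w.+1 -> pth w.+1 i = b.
  by move=> i1 i2 i3; rewrite -(h i) ?ty.
have {wi ty} [bT wi] : b = true /\ w.+1 < q + 8.
  by move: (h w) (h w.+2); rewrite /pth; lia.
move: h; rewrite {}bT => h; move: (h 0) (h 2) (h 4) (h 6) (h 8); rewrite /pth; lia.
Qed.

(** After exchanging [u] and [x], the vertex [y] imitates some [v] that agrees with [w] off u, v, w.
    If [u] and [w] are not adjacent, this already forces the adjacency. If they are consecutive,
    this exchange leaves exceptions near one end of the path only, and the exchange of [w] and [y]
    leaves exceptions near the other end only; the path is too long for both. *)
Lemma tw_tw_inner q g u w x y : frame q g -> outer q x -> outer q y -> x <> y ->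
  0 < u < q + 8 -> 0 < w < q + 8 -> u <> w -> tw q g u x -> tw q g w y ->
  g x y = pth u w.
Proof.
move=> fr ox oy xy ui wi uw tx ty.
have [[b [_ /(tw_nonconst wi ty)//]]|[v vm []]] := swap_typed fr ox ui tx oy (not_eq_sym xy).
have [[b [_ /(tw_nonconst ui tx)//]]|[s sm []]] := swap_typed fr oy wi ty ox xy.
rewrite (fr_sym fr y x) => s1 s2 v1 v2.
have {}s2 i : i < q + 9 -> i <> w -> i <> s -> i <> u -> pth s i = pth u i.
  by move=> *; rewrite -s2 // tx.
have {}v2 i : i < q + 9 -> i <> u -> i <> v -> i <> w -> pth v i = pth w i.
  by move=> *; rewrite -v2 // ty.
case: u w ui wi uw {tx ty} s1 s2 v1 v2 => [//|u] [//|w] ui wi uw s1 s2 v1 v2.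
have [e|ne] := boolP (pth u.+1 w.+1); apply/idP; rewrite ?ne.
  apply/negPn/negP => /negbTE e0; rewrite {}e0 in s1 v1.
  have {e} [e|e] : w = u.+1 \/ u = w.+1 by move: e; rewrite /pth; lia.
    subst w; move: (v2 u.+3) (v2 u.+4) (v2 u.+4.+1) (s2 u) v1 s1.
    case: u {v2} ui wi uw s2 => [|u] ui wi uw s2; [rewrite /pth; lia|move: (s2 u)].
    case: u ui wi uw s2 => [|u] ui wi uw s2; [rewrite /pth; lia|move: (s2 u)].
    rewrite /pth; lia.
  subst u; move: (s2 w.+3) (s2 w.+4) (s2 w.+4.+1) (v2 w) v1 s1.
  case: w {s2} ui wi uw v2 => [|w] ui wi uw v2; [rewrite /pth; lia|move: (v2 w)].
  case: w ui wi uw v2 => [|w] ui wi uw v2; [rewrite /pth; lia|move: (v2 w)].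
  rewrite /pth; lia.
move=> e0; rewrite {}e0 in v1; move: (v2 w) (v2 w.+2) ne v1 {s1 s2}.
rewrite /pth; lia.
Qed.

Section Swap.
Variables (q : nat) (g : rel nat) (u z y : nat).
Hypotheses (fr : frame q g) (oz : outer q z) (ui : 0 < u < q + 8).
Hypotheses (tz : tw q g u z) (oy : outer q y) (yz : y <> z).

Lemma relabel_swap_path i : i < q + 9 -> i <> u -> relabel (swap u z) g y i = g y i.
Proof. by move=> im iu; rewrite /relabel !swap_outer //; move: oz oy; rewrite /outer; lia. Qed.

Lemma relabel_swap_in : relabel (swap u z) g y u = g y z.
Proof.
rewrite /relabel swap_outer //; first by rewrite /swap eqxx.
by move: oy; rewrite /outer; lia.
Qed.

Lemma relabel_swap_out : relabel (swap u z) g y z = g y u.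
Proof.
rewrite /relabel swap_outer //; last by move: oy; rewrite /outer; lia.
by rewrite /swap eqxx; case: eqP => [->|].
Qed.

Lemma relabel_swap_tw : tw q (relabel (swap u z) g) u z.
Proof.
clear oy yz; move=> i im iu; rewrite /relabel /swap eqxx (fr_sym fr).
have -> : (i == u) = false by apply/eqP.
have -> : (i == z) = false by move: oz; rewrite /outer; lia.
have -> : (if z == u then z else u) = u by case: eqP.
by rewrite (fr_sym fr) (fr_path fr) //; move: ui; lia.
Qed.

End Swap.

(** On the path, [x] is adjacent to 1 and possibly to 0. The exceptional case arises when the
    exchange replaces 1 by a vertex not adjacent to [x], leaving [x] without neighbours on the new
    path. Otherwise [x] becomes a twin of some [v], and every [v] is contradictory. *)
Lemma tw_first_inner q g u x y : frame q g -> outer q x -> outer q y -> x <> y ->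
  0 < u < q + 8 -> tw q g 0 x -> tw q g u y -> g x y <> pth 0 u ->
  u = 1 /\ g x 0 = false.
Proof.
move=> fr ox oy xy ui tx ty ne.
have frS := swap_frame fr oy ui ty.
have RP := relabel_swap_path g oy ui ox xy.
have RI := relabel_swap_in g oy ui ox xy.
case: (typed frS ox) => [[b h]|[v vm h]].
  have h' i : i < q + 9 -> i <> u -> g x i = b by move=> i1 i2; rewrite -(h i) // RP.
  have hu : g x y = b by rewrite -(h u) ?RI //; lia.
  move: ne (h' 0) (h' 1) (h' 2) (h' 3) (tx 1) (tx 2) (tx 3).
  by rewrite hu /pth; lia.
have h' i : i < q + 9 -> i <> u -> i <> v -> i <> 0 -> pth 0 i = pth v i.
  by move=> i1 i2 i3 i4; rewrite -h // RP // tx.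
have hu : v <> u -> g x y = pth v u by move=> vu; rewrite -h ?RI //; lia.
(* In the exchanged graph [y] is still a twin of [u], and its adjacency to [x] there is the old
   adjacency of [u] and [x], namely that of [u] and 0. *)
have hB : 0 < v < q + 8 -> v <> u -> pth v u = pth 0 u.
  move=> vi vu; have := tw_tw_inner frS ox oy xy vi ui vu h (relabel_swap_tw fr oy ui).
  rewrite (relabel_swap_out g oy ui ox xy).
  by move=> <-; apply: tx; lia.
have h0 : v <> 0 -> g x 0 = pth v 0 by move=> v0; rewrite -h ?RP //; lia.
case: v vm {h} h' hu hB h0 => [|v] vm h' hu hB h0; first by move: hu; lia.
move: (h' v) (h' v.+2) (h' 1) => {h'}; move: ne hu hB h0; rewrite /pth.
lia.
Qed.

(** After the exchange [y] takes the value [b] on the whole path except at [u]. For [b = true] it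
    has too many neighbours to be a twin; for [b = false] its only neighbour is [u], so it is a twin
    of an end and [u] is next to that end. *)
Lemma const_inner q g u x y b : frame q g -> outer q x -> outer q y -> x <> y ->
  0 < u < q + 8 -> tw q g u x -> const_on q g b y -> g y x <> b ->
  b = false /\ (u = 1 \/ u = q + 7).
Proof.
move=> fr ox oy xy ui tx cy ne.
have [[c [h1 h2]]|[v vm [h1 h2]]] := swap_typed fr ox ui tx oy (not_eq_sym xy).
  case: ne; rewrite h1; case: u ui {tx} h1 h2 => [|u] // ui h1 h2.
  by rewrite -(h2 0) ?cy //; lia.
have {}h2 i : i < q + 9 -> i <> u -> i <> v -> b = pth v i.
  by move=> *; rewrite -h2 // cy.
case: b {cy} ne h2 => ne h2.
  by move: (h2 0) (h2 2) (h2 4) (h2 6) (h2 8); rewrite /pth; lia.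
split=> //; have {}ne : g y x = true by case: (g y x) ne.
move: h1; rewrite {}ne.
case: v vm h2 => [|v] vm h2; first by move: (h2 1); rewrite /pth; lia.
by move: (h2 v) (h2 v.+2); rewrite /pth; lia.
Qed.

(** * Deletions excluding a pair of types *)

(* Otherwise deleting q + 7 and z leaves the path x, 1, .., q + 6, to which y, 0 and q + 8 can be added in turn. *)
Lemma all_first q g x y z : frame q g -> outer q x -> outer q y -> outer q z ->
  x <> y -> x <> z -> y <> z -> tw q g 0 x -> const_on q g true y -> g x y = true.
Proof.
move=> fr ox oy oz xy xz yz tx cy; apply/negPn/negP => /negbTE nxy.
have nyx : g y x = false by rewrite (fr_sym fr).
have sg := fr_sym fr; have P := fr_path fr; have ig := fr_irr fr.
move: (ox) (oy) (oz); rewrite /outer => ox' oy' oz'.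
apply: (@fr_crit _ _ fr (q + 7) z); try alia.
have p1 : primeOn g (fun i => (0 < i < q + 7) || (i == x)).
  have p0 : path_set g 1 (q + 6) (fun i => 0 < i < q + 7).
    by apply: path_set_up => i; [move=> j *; apply: P|]; alia.
  have k4 : 4 <= (q + 6).+1 by alia.
  apply: (path_set_prime (h := x) k4).
  apply: (path_set_cons sg ig p0) => //; try alia.
  by move=> i Yi; move: (tx i); rewrite /pth; alia.
have p2 : primeOn g (fun i => (0 < i < q + 7) || (i == x) || (i == y)).
  apply: (primeOn_ext sg p1) => [|i|b h|u /orP[Yu|/eqP ->] h] //=; first alia.
  - by move: (h 1) (h x) (cy 1) nyx; alia.
  - have {}h w : 0 < w < q + 7 -> w <> u -> pth u w = true.
      by move=> w1 w2; move: (h w) (cy w) (P u w); alia.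
    by move: (h 1) (h 3) (h 5); rewrite /pth; alia.
  - by move: (h 3) (cy 3) (tx 3); rewrite /pth; alia.
have p3 : primeOn g (fun i => (i < q + 7) || (i == x) || (i == y)).
  apply: (primeOn_ext (v := 0) sg p2) => [|i|b h|u /orP[/orP[Yu|/eqP ->]|/eqP ->] h] //=; try alia.
  - by move: (h 2) (h y) (cy 0) (P 0 2); rewrite (sg 0 y) /pth; alia.
  - have {}h w : 0 < w < q + 7 -> w <> u -> pth 0 w = pth u w.
      by move=> w1 w2; move: (h w) (P 0 w) (P u w); alia.
    by case: u Yu h => [//|[|u]] Yu h; [move: (h 2)|move: (h u.+1) (h 3)]; rewrite /pth; alia.
  - by move: (h y) (cy 0) nxy; rewrite (sg 0); alia.
  - by move: (h 2) (cy 2) (P 0 2); rewrite /pth; alia.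
apply: (primeOn_ext (v := q + 8) sg p3) => [|i|b h|u /orP[/orP[Yu|/eqP ->]|/eqP ->] h] //=; try alia.
- by move: (h 2) (h y) (cy (q + 8)) (P (q + 8) 2); rewrite (sg _ y) /pth; alia.
- have {}h w : w < q + 7 -> w <> u -> pth (q + 8) w = pth u w.
    by move=> w1 w2; move: (h w) (P (q + 8) w) (P u w); alia.
  by case: u Yu h => [|u] Yu h; [move: (h 1)|move: (h u)]; rewrite /pth; alia.
- by move: (h 1) (tx 1) (P (q + 8) 1); rewrite /pth; alia.
- by move: (h 2) (cy 2) (P (q + 8) 2); rewrite /pth; alia.
Qed.

(* Otherwise deleting 4 and z leaves the path 3, 2, 1, x, y, q + 7, .., 5, plus 0 and q + 8. *)
Lemma first_last q g x y z : frame q g -> outer q x -> outer q y -> outer q z ->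
  x <> y -> x <> z -> y <> z -> tw q g 0 x -> tw q g (q + 8) y -> g x y = false.
Proof.
move=> fr ox oy oz xy xz yz tx ty; apply/negP => xyT.
have yxT : g y x by rewrite (fr_sym fr).
have sg := fr_sym fr; have P := fr_path fr; have ig := fr_irr fr.
move: (ox) (oy) (oz); rewrite /outer => ox' oy' oz'.
apply: (@fr_crit _ _ fr 4 z); try alia.
have p1 : path_set g (q + 7) (q + 3) (fun i => 5 <= i < q + 8).
  by apply: path_set_down => [i j *|i|]; [apply: P| |]; alia.
have p2 : path_set g y (q + 3).+1 (fun i => (5 <= i < q + 8) || (i == y)).
  apply: (path_set_cons sg ig p1) => //=; try alia.
  by move=> i Yi; move: (ty i); rewrite /pth; alia.
have p3 : path_set g x (q + 3).+2 (fun i => (5 <= i < q + 8) || (i == y) || (i == x)).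
  apply: (path_set_cons sg ig p2) => //=; try alia.
  move=> i /orP[Yi|/eqP->]; last by rewrite xyT eqxx.
  by move: (tx i); rewrite /pth; alia.
have p4 : path_set g 1 (q + 3).+3 (fun i => (5 <= i < q + 8) || (i == y) || (i == x) || (i == 1)).
  apply: (path_set_cons sg ig p3) => //=; try alia.
  move=> i /orP[/orP[Yi|/eqP->]|/eqP->].
  - by move: (P 1 i); rewrite /pth; alia.
  - by move: (ty 1); rewrite sg /pth; alia.
  - by move: (tx 1); rewrite sg /pth; alia.
have p5 : path_set g 2 (q + 3).+4 (fun i => (5 <= i < q + 8) || (i == y) || (i == x) || (0 < i < 3)).
  apply: (path_set_cons sg ig p4) => //=; try alia.
  move=> i /orP[/orP[/orP[Yi|/eqP->]|/eqP->]|/eqP ->].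
  - by move: (P 2 i); rewrite /pth; alia.
  - by move: (ty 2); rewrite sg /pth; alia.
  - by move: (tx 2); rewrite sg /pth; alia.
  - by move: (P 2 1); rewrite /pth; alia.
have p6 : path_set g 3 (q + 3).+4.+1 (fun i => (5 <= i < q + 8) || (i == y) || (i == x) || (0 < i < 4)).
  apply: (path_set_cons sg ig p5) => //=; try alia.
  move=> i /orP[/orP[/orP[Yi|/eqP->]|/eqP->]|Yi].
  - by move: (P 3 i); rewrite /pth; alia.
  - by move: (ty 3); rewrite sg /pth; alia.
  - by move: (tx 3); rewrite sg /pth; alia.
  - by move: (P 3 i); rewrite /pth; alia.
have k4 : 4 <= (q + 3).+4.+1 by alia.
have {p1 p2 p3 p4 p5 p6 k4} r1 := path_set_prime k4 p6.
have r2 : primeOn g (fun i => (5 <= i < q + 8) || (i == y) || (i == x) || (i < 4)).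
  apply: (primeOn_ext (v := 0) sg r1) => [|i|b h|u /orP[/orP[/orP[Yu|/eqP ->]|/eqP ->]|Yu] h] //=; try alia.
  - by move: (h 2) (h 1) (P 0 2) (P 0 1); rewrite /pth; alia.
  - by move: (h 1) (P 0 1) (P u 1); rewrite /pth; alia.
  - by move: (h 1) (P 0 1) (ty 1); rewrite /pth; alia.
  - by move: (h y) (ty 0) xyT; rewrite (sg 0 y) /pth; alia.
  - have {Yu} [e|[e|e]] : u = 1 \/ u = 2 \/ u = 3 by alia.
    + by subst; move: (h 2) (P 0 2) (P 1 2); rewrite /pth; alia.
    + by subst; move: (h 3) (P 0 3) (P 2 3); rewrite /pth; alia.
    + by subst; move: (h 2) (h 1) (P 0 2) (P 3 2); rewrite /pth; alia.
apply: (primeOn_ext (v := q + 8) sg r2) => [|i|b h|u /orP[/orP[/orP[Yu|/eqP ->]|/eqP ->]|Yu] h] //=; try alia.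
- by move: (h 2) (h (q + 7)) (P (q + 8) 2) (P (q + 8) (q + 7)); rewrite /pth; alia.
- have {}h w : 5 <= w < q + 8 -> w <> u -> pth (q + 8) w = pth u w.
    by move=> w1 w2; move: (h w) (P (q + 8) w) (P u w); alia.
  by move: (h (q + 7)) (h (q + 6)) (h (q + 5)); rewrite /pth; alia.
- by move: (h x) (tx (q + 8)) yxT; rewrite (sg _ x) /pth; alia.
- by move: (h (q + 7)) (tx (q + 7)) (P (q + 8) (q + 7)); rewrite /pth; alia.
- by move: (h (q + 7)) (P (q + 8) (q + 7)) (P u (q + 7)); rewrite /pth; alia.
Qed.

(* If x ~ 0, deleting 3 and 4 leaves the path 2, 1, x, a, z, q + 7, .., 5, plus 0 and q + 8;
   otherwise deleting 2 and 3 leaves the path 0, 1, x, a, z, q + 7, .., 4, plus q + 8. *)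
Lemma iso_first_last q g a x z : frame q g -> outer q a -> outer q x -> outer q z ->
  a <> x -> a <> z -> x <> z -> const_on q g false a -> tw q g 0 x -> tw q g (q + 8) z ->
  g a x -> g a z -> False.
Proof.
move=> fr oa ox oz ax az xz ca tx tz axT azT.
have xz0 : g x z = false by apply: (first_last fr ox oz oa) => // /esym.
have sg := fr_sym fr; have P := fr_path fr; have ig := fr_irr fr.
have xaT : g x a by rewrite sg.
have zaT : g z a by rewrite sg.
have zx0 : g z x = false by rewrite sg.
move: (oa) (ox) (oz); rewrite /outer => oa' ox' oz'.
have nz i : i < 3 -> g i z = false by move=> ?; rewrite sg tz /pth; alia.
have na i : i < q + 9 -> g i a = false by move=> ?; rewrite sg ca.
(* The part common to both cases: the path 1, x, a, z, q + 7, ..., s. *)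
have pb s k : 4 <= s -> s + k = q + 8 -> 0 < k ->
    path_set g 1 k.+4 (fun i => (s <= i < q + 8) || (i == z) || (i == a) || (i == x) || (i == 1)).
  move=> s4 sk k0.
  have p1 : path_set g (q + 7) k (fun i => s <= i < q + 8).
    by apply: path_set_down => [i j *|i|]; [apply: P| |]; alia.
  have p2 : path_set g z k.+1 (fun i => (s <= i < q + 8) || (i == z)).
    apply: (path_set_cons sg ig p1) => //=; try alia.
    by move=> i Yi; move: (tz i); rewrite /pth; alia.
  have p3 : path_set g a k.+2 (fun i => (s <= i < q + 8) || (i == z) || (i == a)).
    apply: (path_set_cons sg ig p2) => //=; try alia.
    move=> i /orP[Yi|/eqP->]; last by rewrite azT eqxx.
    by move: (ca i); alia.
  have p4 : path_set g x k.+3 (fun i => (s <= i < q + 8) || (i == z) || (i == a) || (i == x)).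
    apply: (path_set_cons sg ig p3) => //=; try alia.
    move=> i /orP[/orP[Yi|/eqP->]|/eqP->]; [|by move: xz0; alia|by rewrite xaT eqxx].
    by move: (tx i); rewrite /pth; alia.
  apply: (path_set_cons sg ig p4) => //=; try alia.
  move=> i /orP[/orP[/orP[Yi|/eqP->]|/eqP->]|/eqP->].
  - by move: (P 1 i); rewrite /pth; alia.
  - by move: (nz 1); alia.
  - by move: (na 1); alia.
  - by move: (tx 1); rewrite sg /pth; alia.
case x0 : (g x 0).
- apply: (@fr_crit _ _ fr 3 4); try alia.
  have p1 : path_set g 2 (q + 3).+4.+1 (fun i => (5 <= i < q + 8) || (i == z) || (i == a) || (i == x) || (0 < i < 3)).
    apply: (path_set_cons sg ig (pb 5 (q + 3) _ _ _)) => //=; try alia.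
    move=> i /orP[/orP[/orP[/orP[Yi|/eqP->]|/eqP->]|/eqP->]|/eqP->].
    - by move: (P 2 i); rewrite /pth; alia.
    - by move: (nz 2); alia.
    - by move: (na 2); alia.
    - by move: (tx 2); rewrite sg /pth; alia.
    - by move: (P 2 1); rewrite /pth; alia.
  have k4 : 4 <= (q + 3).+4.+1 by alia.
  have {k4 p1} r1 := path_set_prime k4 p1.
  have r2 : primeOn g (fun i => (5 <= i < q + 8) || (i == z) || (i == a) || (i == x) || (i < 3)).
    apply: (primeOn_ext (v := 0) sg r1) => [|i|b h|u /orP[/orP[/orP[/orP[Yu|/eqP ->]|/eqP ->]|/eqP->]|Yu] h] //=; try alia.
    - by move: (h 2) (h 1) (P 0 2) (P 0 1); rewrite /pth; alia.
    - by move: (h 1) (P 0 1) (P u 1); rewrite /pth; alia.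
    - by move: (h 1) (P 0 1) (tz 1); rewrite /pth; alia.
    - by move: (h 1) (P 0 1) (ca 1); rewrite /pth; alia.
    - by move: (h a) (na 0) xaT; alia.
    - have {Yu} [e|e] : u = 1 \/ u = 2 by alia.
      + by subst; move: (h 2) (P 0 2) (P 1 2); rewrite /pth; alia.
      + by subst; move: (h x) (tx 2) x0; rewrite (sg 0 x) (sg 2 x) /pth; alia.
  apply: (primeOn_ext (v := q + 8) sg r2) => [|i|b h|u /orP[/orP[/orP[/orP[Yu|/eqP ->]|/eqP ->]|/eqP->]|Yu] h] //=; try alia.
  - by move: (h 2) (h (q + 7)) (P (q + 8) 2) (P (q + 8) (q + 7)); rewrite /pth; alia.
  - have {}h w : 5 <= w < q + 8 -> w <> u -> pth (q + 8) w = pth u w.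
      by move=> w1 w2; move: (h w) (P (q + 8) w) (P u w); alia.
    by move: (h (q + 7)) (h (q + 6)) (h (q + 5)); rewrite /pth; alia.
  - by move: (h a) (na (q + 8)) zaT; alia.
  - by move: (h (q + 7)) (ca (q + 7)) (P (q + 8) (q + 7)); rewrite /pth; alia.
  - by move: (h (q + 7)) (tx (q + 7)) (P (q + 8) (q + 7)); rewrite /pth; alia.
  - by move: (h (q + 7)) (P (q + 8) (q + 7)) (P u (q + 7)); rewrite /pth; alia.
- apply: (@fr_crit _ _ fr 2 3); try alia.
  have p1 : path_set g 0 (q + 4).+4.+1 (fun i => (4 <= i < q + 8) || (i == z) || (i == a) || (i == x) || (i < 2)).
    apply: (path_set_cons sg ig (pb 4 (q + 4) _ _ _)) => //=; try alia.
    move=> i /orP[/orP[/orP[/orP[Yi|/eqP->]|/eqP->]|/eqP->]|/eqP->].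
    - by move: (P 0 i); rewrite /pth; alia.
    - by move: (nz 0); alia.
    - by move: (na 0); alia.
    - by rewrite sg x0; alia.
    - by move: (P 0 1); rewrite /pth; alia.
  have k4 : 4 <= (q + 4).+4.+1 by alia.
  have {k4 p1} r1 := path_set_prime k4 p1.
  apply: (primeOn_ext (v := q + 8) sg r1) => [|i|b h|u /orP[/orP[/orP[/orP[Yu|/eqP ->]|/eqP ->]|/eqP->]|Yu] h] //=; try alia.
  - by move: (h 1) (h (q + 7)) (P (q + 8) 1) (P (q + 8) (q + 7)); rewrite /pth; alia.
  - have {}h w : 4 <= w < q + 8 -> w <> u -> pth (q + 8) w = pth u w.
      by move=> w1 w2; move: (h w) (P (q + 8) w) (P u w); alia.
    by move: (h (q + 7)) (h (q + 6)) (h (q + 5)); rewrite /pth; alia.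
  - by move: (h a) (na (q + 8)) zaT; alia.
  - by move: (h (q + 7)) (ca (q + 7)) (P (q + 8) (q + 7)); rewrite /pth; alia.
  - by move: (h (q + 7)) (tx (q + 7)) (P (q + 8) (q + 7)); rewrite /pth; alia.
  - by move: (h (q + 7)) (P (q + 8) (q + 7)) (P u (q + 7)); rewrite /pth; alia.
Qed.

(* Otherwise deleting q + 6 and q + 7 leaves the path a, x, 1, .., q + 5, plus 0, z and q + 8. *)
Lemma iso_all_first q g a x z : frame q g -> outer q a -> outer q x -> outer q z ->
  a <> x -> a <> z -> x <> z -> const_on q g false a -> tw q g 0 x -> const_on q g true z ->
  g a x -> g a z.
Proof.
move=> fr oa ox oz ax az xz ca tx cz axT; apply/negPn/negP => /negbTE az0.
have xzT : g x z by apply: (all_first fr ox oz oa) => // /esym.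
have sg := fr_sym fr; have P := fr_path fr; have ig := fr_irr fr.
have xaT : g x a by rewrite sg.
have zxT : g z x by rewrite sg.
have za0 : g z a = false by rewrite sg.
have na i : i < q + 9 -> g i a = false by move=> ?; rewrite sg ca.
have nz i : i < q + 9 -> g i z = true by move=> ?; rewrite sg cz.
move: (oa) (ox) (oz); rewrite /outer => oa' ox' oz'.
apply: (@fr_crit _ _ fr (q + 6) (q + 7)); try alia.
have p1 : path_set g 1 (q + 5) (fun i => 0 < i < q + 6).
  by apply: path_set_up => i; [move=> j *; apply: P|]; alia.
have p2 : path_set g x (q + 5).+1 (fun i => (0 < i < q + 6) || (i == x)).
  apply: (path_set_cons sg ig p1) => //=; try alia.
  by move=> i Yi; move: (tx i); rewrite /pth; alia.
have p3 : path_set g a (q + 5).+2 (fun i => (0 < i < q + 6) || (i == x) || (i == a)).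
  apply: (path_set_cons sg ig p2) => //=; try alia.
  move=> i /orP[Yi|/eqP->]; last by rewrite axT eqxx.
  by move: (ca i); alia.
have k4 : 4 <= (q + 5).+2 by alia.
have {p1 p2 p3 k4} r1 := path_set_prime k4 p3.
have r2 : primeOn g (fun i => (i < q + 6) || (i == x) || (i == a)).
  apply: (primeOn_ext (v := 0) sg r1) => [|i|b h|u /orP[/orP[Yu|/eqP ->]|/eqP ->] h] //=; try alia.
  - by move: (h 2) (h 1) (P 0 2) (P 0 1); rewrite /pth; alia.
  - have {}h w : 0 < w < q + 6 -> w <> u -> pth 0 w = pth u w.
      by move=> w1 w2; move: (h w) (P 0 w) (P u w); alia.
    by move: (h 1) (h 2) (h 3); rewrite /pth; alia.
  - by move: (h a) (na 0) xaT; alia.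
  - by move: (h 1) (P 0 1) (ca 1); rewrite /pth; alia.
have r3 : primeOn g (fun i => (i < q + 6) || (i == x) || (i == a) || (i == z)).
  apply: (primeOn_ext (v := z) sg r2) => [|i|b h|u /orP[/orP[Yu|/eqP ->]|/eqP ->] h] //=; try alia.
  - by move: (h a) (h 1) (cz 1) za0; alia.
  - have {}h w : w < q + 6 -> w <> u -> true = pth u w.
      by move=> w1 w2; move: (h w) (cz w) (P u w); alia.
    by move: (h 1) (h 3) (h 5); rewrite /pth; alia.
  - by move: (h 3) (cz 3) (tx 3); rewrite /pth; alia.
  - by move: (h 1) (cz 1) (ca 1); rewrite /pth; alia.
apply: (primeOn_ext (v := q + 8) sg r3) => [|i|b h|u /orP[/orP[/orP[Yu|/eqP ->]|/eqP ->]|/eqP->] h] //=; try alia.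
- by move: (h 1) (h z) (nz (q + 8)) (P (q + 8) 1); rewrite /pth; alia.
- have {}h w : w < q + 6 -> w <> u -> pth (q + 8) w = pth u w.
    by move=> w1 w2; move: (h w) (P (q + 8) w) (P u w); alia.
  by case: u Yu h => [|u] Yu h; [move: (h 1)|move: (h u)]; rewrite /pth; alia.
- by move: (h 1) (tx 1) (P (q + 8) 1); rewrite /pth; alia.
- by move: (h z) (nz (q + 8)) az0; alia.
- by move: (h 1) (cz 1) (P (q + 8) 1); rewrite /pth; alia.
Qed.

(** * Normal forms *)

(** The vertices a, b, c stand for the labels n - 2, n - 1, n. In this and the next two definitions
    the edges of G_X are expanded into adjacencies: a vertex of X^- and a twin of 0 or 1 form an
    edge iff they are adjacent, a twin of 0 and a twin of 1 iff they are not, and two vertices of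
    the same type never. *)
Definition cfg_i q (g : rel nat) a b c : Prop :=
  [/\ const_on q g false a, const_on q g false b, tw q g 0 c &
      [/\ g b c, ~~ g a c & g a b]].

Definition cfg_ii q (g : rel nat) a b c : Prop :=
  [/\ const_on q g false a, tw q g 1 b, tw q g 0 c,
      [|| g a b && g a c, g a b && ~~ g b c | g a c && ~~ g b c] &
      ~~ g b c -> g c 0 = false].

Definition cfg_iii q (g : rel nat) a b c : Prop := exists u,
  [/\ u = 0 \/ u = 1, const_on q g false a, tw q g u b, tw q g u c &
      [&& g a b, g a c & g b u != g c u] || [&& ~~ g a b, g a c & g c b != g c u]].

Definition cfg q g a b c : Prop :=
  [\/ cfg_i q g a b c, cfg_ii q g a b c | cfg_iii q g a b c].

(** The isomorphism is a bijection [s] of the naturals with inverse [t]. It need not fix the path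
    pointwise: the relabelled graph must induce the standard path, which admits exchanges and the
    reversal. *)
Definition good q (g : rel nat) : Prop := exists s t : nat -> nat,
  [/\ cancel s t, cancel t s, forall i, (s i < q + 12) = (i < q + 12),
      forall i j, i < q + 9 -> j < q + 9 -> relabel s g i j = pth i j &
      cfg q (relabel s g) (q + 9) (q + 10) (q + 11)].

Lemma good_relabel q g s : involutive s -> (forall i, (s i < q + 12) = (i < q + 12)) ->
  good q (relabel s g) -> good q g.
Proof.
move=> sK sn [t [t' [tK t'K tn tp tc]]]; exists (s \o t), (t' \o s); split=> //.
- by move=> i /=; rewrite sK tK.
- by move=> i /=; rewrite t'K sK.
- by move=> i /=; rewrite sn tn.
Qed.

Definition outers q a b c : Prop :=
  [/\ outer q a, outer q b, outer q c & [/\ a <> b, a <> c & b <> c]].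

Lemma outersP q a b c : outers q a b c ->
  forall v, v < q + 12 -> [\/ v < q + 9, v = a, v = b | v = c].
Proof.
case=> + + + [ab ac bc] v; rewrite /outer => ha hb hc vn.
case: (ltnP v (q + 9)) => h; first by constructor 1.
have [|[|]] : v = a \/ v = b \/ v = c by lia.
- by constructor 2.
- by constructor 3.
- by constructor 4.
Qed.

(** Permuting only the three outer labels brings the triple into the standard order. *)
Lemma good_intro q g a b c : frame q g -> outers q a b c -> cfg q g a b c -> good q g.
Proof.
move=> fr o; have [] := o; rewrite /outer => ha hb hc [ab ac bc] h.
pose s i := if i == q + 9 then a else if i == q + 10 then b else if i == q + 11 then c else i.
pose t i := if i == a then q + 9 else if i == b then q + 10 else if i == c then q + 11 else i.
have e1 : (q + 10 == q + 9) = false by lia.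
have e2 : (q + 11 == q + 9) = false by lia.
have e3 : (q + 11 == q + 10) = false by lia.
have e4 : (b == a) = false by lia.
have e5 : (c == a) = false by lia.
have e6 : (c == b) = false by lia.
have s9 : s (q + 9) = a by rewrite /s eqxx.
have s10 : s (q + 10) = b by rewrite /s e1 eqxx.
have s11 : s (q + 11) = c by rewrite /s e2 e3 eqxx.
have ta : t a = q + 9 by rewrite /t eqxx.
have tb : t b = q + 10 by rewrite /t e4 eqxx.
have tc : t c = q + 11 by rewrite /t e5 e6 eqxx.
have id i : ~~ outer q i -> s i = i /\ t i = i.
  rewrite /outer => oi; rewrite /s /t.
  have -> : (i == q + 9) = false by lia.
  have -> : (i == q + 10) = false by lia.
  have -> : (i == q + 11) = false by lia.
  have -> : (i == a) = false by lia.
  have -> : (i == b) = false by lia.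
  by have -> : (i == c) = false by lia.
have sp i : i < q + 9 -> s i = i by move=> h1; case: (id i) => //; rewrite /outer; lia.
have ot i : outer q i -> [\/ i = q + 9, i = q + 10 | i = q + 11].
  rewrite /outer => oi; have [|[|]] : i = q + 9 \/ i = q + 10 \/ i = q + 11 by lia.
  - by constructor 1.
  - by constructor 2.
  - by constructor 3.
have oabc i : outer q i -> [\/ i = a, i = b | i = c].
  move=> /andP[i1 i2]; case: (outersP o i2) => h1.
  - by lia.
  - by constructor 1.
  - by constructor 2.
  - by constructor 3.
exists s, t; split.
- move=> i; case oi : (outer q i); last by case: (id i (negbT oi)) => si ti; rewrite ?si ?ti ?si.
  by case: (ot i oi) => ->; rewrite ?s9 ?s10 ?s11.
- move=> i; case oi : (outer q i); last by case: (id i (negbT oi)) => si ti; rewrite ?si ?ti ?si.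
  by case: (oabc i oi) => ->; rewrite ?ta ?tb ?tc ?s9 ?s10 ?s11.
- move=> i; case oi : (outer q i); last by case: (id i (negbT oi)) => si ti; rewrite ?si ?ti ?si.
  by case: (ot i oi) => ->; rewrite ?s9 ?s10 ?s11; lia.
- by move=> i j i9 j9; rewrite /relabel !sp // (fr_path fr).
have q1 : 1 < q + 9 by lia.
have q0 : 0 < q + 9 by lia.
case: h => [[h1 h2 h3 h4]|[h1 h2 h3 h4 h5]|[u [u01 h1 h2 h3 h4]]].
- constructor 1; split; rewrite /relabel ?s9 ?s10 ?s11 //.
  + by move=> i i9; rewrite s9 sp ?h1.
  + by move=> i i9; rewrite s10 sp ?h2.
  + by move=> i i9; rewrite s11 sp //; apply: h3.
- constructor 2; split; rewrite /relabel ?s9 ?s10 ?s11 ?(sp 0) //.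
  + by move=> i i9; rewrite s9 sp ?h1.
  + by move=> i i9; rewrite s10 sp //; apply: h2.
  + by move=> i i9; rewrite s11 sp //; apply: h3.
- constructor 3; exists u; split; rewrite /relabel ?s9 ?s10 ?s11 ?(sp u) //.
  + by move=> i i9; rewrite s9 sp ?h1.
  + by move=> i i9; rewrite s10 sp //; apply: h2.
  + by move=> i i9; rewrite s11 sp //; apply: h3.
  + by case: u01 => ->.
Qed.

(** * Separations forced by the indecomposability of the whole graph *)

Lemma frame_interval q g (I : pred nat) i j k : frame q g ->
  (forall i, I i -> i < q + 12) -> I i -> I j -> i <> j -> k < q + 12 -> ~~ I k ->
  ~ (forall v i j, v < q + 12 -> ~~ I v -> I i -> I j -> g v i = g v j).
Proof.
move=> fr In Ii Ij ij kn nIk iI; case: (fr_prime fr In iI) => [sg|al].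
  by case: ij; apply: sg.
by rewrite al in nIk.
Qed.

Lemma frame_pair q g x y : frame q g -> x < q + 12 -> y < q + 12 -> x <> y ->
  ~ (forall v, v < q + 12 -> v <> x -> v <> y -> g v x = g v y).
Proof.
move=> fr xn yn xy h.
have [k [kn kx ky]] : exists k, [/\ k < q + 12, k <> x & k <> y].
  have [|[|]] : (0 <> x /\ 0 <> y) \/ (1 <> x /\ 1 <> y) \/ (2 <> x /\ 2 <> y) by lia.
  - by case=> *; exists 0; split=> //; lia.
  - by case=> *; exists 1; split=> //; lia.
  - by case=> *; exists 2; split=> //; lia.
have In i : (i == x) || (i == y) -> i < q + 12 by case/orP => /eqP->.
have Ix : (x == x) || (x == y) by rewrite eqxx.
have Iy : (y == x) || (y == y) by rewrite eqxx orbT.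
have Ik : ~~ ((k == x) || (k == y)) by rewrite negb_or; apply/andP; split; apply/eqP.
apply: (frame_interval fr In Ix Iy xy kn Ik) => v i j vn.
rewrite negb_or => /andP[/eqP vx /eqP vy].
by case/orP=> /eqP-> /orP[] /eqP-> //; rewrite h.
Qed.

Lemma frame_isolated q g b y : frame q g -> y < q + 12 ->
  ~ (forall v, v < q + 12 -> v <> y -> g y v = b).
Proof.
move=> fr yn h.
have [i [j [ij iy jy i2 j2]]] : exists i j, [/\ i <> j, i <> y, j <> y, i < 3 & j < 3].
  case: y {yn h} => [|[|y]]; [exists 1, 2|exists 0, 2|exists 0, 1]; split=> //; lia.
pose I k := (k < q + 12) && (k != y).
have In k : I k -> k < q + 12 by case/andP.
have Ii : I i by rewrite /I; apply/andP; split; [lia|apply/eqP].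
have Ij : I j by rewrite /I; apply/andP; split; [lia|apply/eqP].
have Iy : ~~ I y by rewrite /I eqxx andbF.
apply: (frame_interval fr In Ii Ij ij yn Iy) => v k l vn.
rewrite /I vn negbK => /eqP-> /andP[k1 /eqP k2] /andP[l1 /eqP l2].
by rewrite !h.
Qed.

(** The vertices [w] and [b] agree on the rest of the path, so an outer vertex must separate them;
    if [a] does not, [c] does. *)
Lemma frame_twin q g a b c w : frame q g -> outers q a b c -> w < q + 9 -> tw q g w b ->
  g a b = g a w -> ~ g c b = g c w.
Proof.
move=> fr o w9 tb ha hc; have [/andP[_ a1] /andP[b0 b1] /andP[_ c1] _] := o.
have wn : w < q + 12 by lia.
have wb : w <> b by lia.
apply: (frame_pair fr wn b1 wb) => v vn vw vb.
case: (outersP o vn) => [v9|e|//|e]; subst => //.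
by rewrite (fr_path fr) // (fr_sym fr v b) tb // pthC.
Qed.

(** * Reversal of the path *)

Definition mirror q i := if i < q + 9 then q + 8 - i else i.

Lemma mirrorK q : involutive (mirror q).
Proof.
move=> i; rewrite /mirror; case: (ltnP i (q + 9)) => h; last by rewrite ifF //; apply/negbTE; rewrite -leqNgt.
have h' : q + 8 - i < q + 9 by lia.
by rewrite h' subKn //; lia.
Qed.

Lemma mirror_lt q i : (mirror q i < q + 12) = (i < q + 12).
Proof. by rewrite /mirror; case: (ltnP i (q + 9)); lia. Qed.

Lemma mirror_outer q z : outer q z -> mirror q z = z.
Proof. by rewrite /outer /mirror; case: (ltnP z (q + 9)); lia. Qed.

Lemma mirror_frame q g : frame q g -> frame q (relabel (mirror q) g).
Proof.
move=> fr; apply: (relabel_frame fr (@mirrorK q) (@mirror_lt q)).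
- by move=> i; rewrite /mirror; case: (ltnP i (q + 9)); lia.
- move=> i j i9 j9; rewrite /relabel /mirror i9 j9 (fr_path fr) /pth; try lia.
Qed.

Lemma mirror_tw q g u z : outer q z -> u < q + 9 -> tw q g u z ->
  tw q (relabel (mirror q) g) (q + 8 - u) z.
Proof.
move=> oz u9 tz i i9 iu; rewrite /relabel mirror_outer // /mirror i9 tz /pth; lia.
Qed.

Lemma mirror_const q g b z : outer q z -> const_on q g b z -> const_on q (relabel (mirror q) g) b z.
Proof. by move=> oz cz i i9; rewrite /relabel mirror_outer // /mirror i9 cz //; lia. Qed.

Lemma mirror_edge q g y z : outer q y -> outer q z -> relabel (mirror q) g y z = g y z.
Proof. by move=> oy oz; rewrite /relabel !mirror_outer. Qed.

Lemma tw_last_inner q g u x y : frame q g -> outer q x -> outer q y -> x <> y ->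
  0 < u < q + 8 -> tw q g (q + 8) x -> tw q g u y -> g x y <> pth (q + 8) u ->
  u = q + 7.
Proof.
move=> fr ox oy xy ui tx ty ne.
have q8 : q + 8 < q + 9 by lia.
have u9 : u < q + 9 by lia.
have tx' := mirror_tw ox q8 tx; rewrite subnn in tx'.
have [||e _] := tw_first_inner (mirror_frame fr) ox oy xy _ tx' (mirror_tw oy u9 ty).
- by lia.
- by rewrite mirror_edge //; move: ne; rewrite /pth; lia.
- by lia.
Qed.

(** * From an unexpected pair to a normal form: the type of the third vertex *)

Lemma outersC12 q a b c : outers q a b c -> outers q b a c.
Proof. by case=> oa ob oc [ab ac bc]; split=> //; split=> // /esym. Qed.

Lemma outersC23 q a b c : outers q a b c -> outers q a c b.
Proof. by case=> oa ob oc [ab ac bc]; split=> //; split=> // /esym. Qed.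

(** The two alternatives of (iii) come from two pairs that must be separated. If [a] is adjacent to
    both [b] and [c], only [u] can separate [b] from [c]; if [a] is not adjacent to [b], only [c]
    can separate [u] from [b]. *)
Lemma good_same q g u a b c : frame q g -> outers q a b c -> u = 0 \/ u = 1 ->
  const_on q g false a -> tw q g u b -> tw q g u c -> g a c -> good q g.
Proof.
move=> fr o u01 ca tb tc ac; have [/andP[a0 a1] /andP[b0 b1] /andP[c0 c1] [nab nac nbc]] := o.
have u9 : u < q + 9 by case: u01 => ->; lia.
have sg := fr_sym fr.
apply: (good_intro fr o); constructor 3; exists u; split=> //.
rewrite ac; case ab: (g a b) => /=; rewrite ?orbF; apply/negP => /eqP e.
- apply: (frame_pair fr b1 c1 nbc) => v vn vb vc.
  case: (outersP o vn) => [v9|->|//|//]; last by rewrite ab ac.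
  case: (eqVneq v u) => [->|/eqP vu]; first by rewrite sg e sg.
  by rewrite sg tb // sg tc.
- by apply: (frame_twin fr o u9 tb _ e); rewrite ab ca.
Qed.

(** If [a] is adjacent to just one of [b], [c], then [b] and [c] cannot be adjacent: otherwise {0,
    c} or {1, b} would be an interval of the whole graph. This supplies the second edge of G_X. The
    last condition of (ii) is the exceptional case of [tw_first_inner]. *)
Lemma good_first_second q g a b c : frame q g -> outers q a b c ->
  const_on q g false a -> tw q g 1 b -> tw q g 0 c -> g a b || g a c -> good q g.
Proof.
move=> fr o ca tb tc ac; have [oa ob oc [nab nac nbc]] := o.
have sg := fr_sym fr; have h0 : 0 < q + 9 by lia.
have h1 : 1 < q + 9 by lia.
apply: (good_intro fr o); constructor 2; split=> //.
- case abE: (g a b) ac => /=; case acE: (g a c) => //= _.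
  + rewrite ?orbF; apply/negP => bc; apply: (frame_twin fr (outersC23 o) h0 tc).
      by rewrite acE ca.
    by rewrite bc tb.
  + rewrite ?orbF; apply/negP => bc; apply: (frame_twin fr o h1 tb).
      by rewrite abE ca.
    by rewrite sg bc tc.
- move=> bc; have [] // := tw_first_inner fr oc ob (not_eq_sym nbc) _ tc tb.
  + by lia.
  + by rewrite sg (negbTE bc) /pth.
Qed.

Lemma good_iso_first q g a b c : frame q g -> outers q a b c ->
  const_on q g false a -> tw q g 0 c -> g a c -> good q g.
Proof.
move=> fr o ca tc ac; have [oa ob oc [nab nac nbc]] := o.
have sg := fr_sym fr.
have [/andP[a0 a1] /andP[b0 b1] /andP[c0 c1]] := And3 oa ob oc.
have [nba nca ncb] := And3 (not_eq_sym nab) (not_eq_sym nac) (not_eq_sym nbc).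
case: (typed fr ob) => [[[] cb]|[w w9 tb]].
- exfalso; have cbT := all_first fr oc ob oa ncb nca nba tc cb.
  have abT := iso_all_first fr oa oc ob nac nab ncb ca tc cb ac.
  apply: (@frame_isolated q g true b fr b1) => v vn vb.
  case: (outersP o vn) => [v9|->|//|->]; [exact: cb|by rewrite sg|by first [done|rewrite sg]].
- have nbcE : g b c = false.
    apply/negP => bcT; apply: (frame_pair fr a1 b1 nab) => v vn va vb.
    case: (outersP o vn) => [v9|//|//|->]; last by rewrite sg ac sg bcT.
    by rewrite sg ca // sg cb.
  have abT : g a b.
    apply/negPn/negP => /negbTE abE; apply: (@frame_isolated q g false b fr b1) => v vn vb.
    case: (outersP o vn) => [v9|->|//|->]; [exact: cb|by rewrite sg|by first [done|rewrite sg]].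
  (* In (i) the vertex of X^- adjacent to the twin of 0 comes second, so [a] and [b] change
     roles. *)
  apply: (good_intro fr (outersC12 o)); constructor 1; split=> //; split=> //.
    by rewrite nbcE.
  by rewrite sg.
- case: (eqVneq w 0) => [w0|/eqP w0].
    by rewrite w0 in tb; apply: (good_same fr o _ ca tb tc ac); left.
  case: (eqVneq w 1) => [w1|/eqP w1].
    by rewrite w1 in tb; apply: (good_first_second fr o ca tb tc); rewrite ac orbT.
  exfalso; have cw : g c w = pth 0 w by apply: tc.
  case: (eqVneq w (q + 8)) => [w8|/eqP w8].
    rewrite w8 in tb w9 cw.
    have cbE := first_last fr oc ob oa ncb nca nba tc tb.
    case abE: (g a b).
      exact: (iso_first_last fr oa oc ob nac nab ncb ca tc tb ac abE).
    apply: (frame_twin fr o w9 tb); first by rewrite abE ca.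
    by rewrite cbE cw /pth; lia.
  have wi : 0 < w < q + 8 by lia.
  have cbE : g c b = pth 0 w.
    apply/eqP/negPn/negP => /eqP ne.
    by have [/w1] := tw_first_inner fr oc ob ncb wi tc tb ne.
  case abE: (g a b); last first.
    by apply: (frame_twin fr o w9 tb); rewrite ?abE ?ca // cbE cw.
  have w7 : w = q + 7.
    have ne : g a b <> false by rewrite abE.
    by have [_ [/w1|//]] := const_inner fr ob oa nba wi tb ca ne.
  (* Exchanging q + 7 and [b] gives [a] the single path neighbour q + 7, hence makes it a twin of q
     + 8. It is still adjacent to [c], a twin of 0, which [first_last] forbids. *)
  have frS := swap_frame fr ob wi tb.
  have ta' : tw q (relabel (swap w b) g) (q + 8) a.
    move=> i i9 ii; case: (eqVneq i w) => [->|/eqP iw].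
      by rewrite (relabel_swap_in g ob wi oa nab) abE w7 /pth; lia.
    by rewrite (relabel_swap_path g ob wi oa nab) // ca // /pth; lia.
  have tc' : tw q (relabel (swap w b) g) 0 c.
    move=> i i9 ii; case: (eqVneq i w) => [->|/eqP iw].
      by rewrite (relabel_swap_in g ob wi oc ncb) cbE.
    by rewrite (relabel_swap_path g ob wi oc ncb) // tc.
  have := first_last frS oc oa ob nca ncb nab tc' ta'.
  by rewrite /relabel !swap_outer ?(fr_sym fr c a) ?ac //; lia.
Qed.

(** Exchanging 1 and [c] gives [a] the single path neighbour 1, hence makes it a twin of 0. The
    facts about end twins then apply to [a] and [b] in the exchanged graph. *)
Lemma good_iso_second q g a b c : frame q g -> outers q a b c ->
  const_on q g false a -> tw q g 1 c -> g a c -> good q g.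
Proof.
move=> fr o ca tc ac; have [oa ob oc [nab nac nbc]] := o.
have sg := fr_sym fr.
have [/andP[a0 a1] /andP[b0 b1] /andP[c0 c1]] := And3 oa ob oc.
have [nba nca ncb] := And3 (not_eq_sym nab) (not_eq_sym nac) (not_eq_sym nbc).
have i1 : 0 < 1 < q + 8 by lia.
have frS := swap_frame fr oc i1 tc.
have ta' : tw q (relabel (swap 1 c) g) 0 a.
  move=> i i9 ii; case: (eqVneq i 1) => [->|/eqP iw].
    by rewrite (relabel_swap_in g oc i1 oa nac) ac /pth; lia.
  by rewrite (relabel_swap_path g oc i1 oa nac) // ca // /pth; lia.
have eab : relabel (swap 1 c) g a b = g a b.
  by rewrite /relabel !swap_outer //; lia.
case: (typed fr ob) => [[[] cb]|[w w9 tb]].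
- exfalso; have bcT : g b c.
    apply/negPn/negP => /negbTE bcE; have ne : g b c <> true by rewrite bcE.
    by have [] := const_inner fr oc ob ncb i1 tc cb ne.
  have cb' : const_on q (relabel (swap 1 c) g) true b.
    move=> i i9; case: (eqVneq i 1) => [->|/eqP iw].
      by rewrite (relabel_swap_in g oc i1 ob nbc) bcT.
    by rewrite (relabel_swap_path g oc i1 ob nbc) // cb.
  have := all_first frS oa ob oc nab nac nbc ta' cb'.
  rewrite eab => abT; apply: (@frame_isolated q g true b fr b1) => v vn vb.
  case: (outersP o vn) => [v9|->|//|->]; [exact: cb|by rewrite sg|by first [done|rewrite sg]].
- have nbcE : g b c = false.
    apply/negP => bcT; apply: (frame_pair fr a1 b1 nab) => v vn va vb.
    case: (outersP o vn) => [v9|//|//|->]; last by rewrite sg ac sg bcT.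
    by rewrite sg ca // sg cb.
  have abT : g a b.
    apply/negPn/negP => /negbTE abE; apply: (@frame_isolated q g false b fr b1) => v vn vb.
    case: (outersP o vn) => [v9|->|//|->]; [exact: cb|by rewrite sg|by first [done|rewrite sg]].
  have cb' : const_on q (relabel (swap 1 c) g) false b.
    move=> i i9; case: (eqVneq i 1) => [->|/eqP iw].
      by rewrite (relabel_swap_in g oc i1 ob nbc) nbcE.
    by rewrite (relabel_swap_path g oc i1 ob nbc) // cb.
  apply: (good_relabel (swapK 1 c)).
    by move=> i; rewrite /swap; case: eqP => [->|_]; [lia|case: eqP => [->|]; lia].
  have oS : outers q b c a by apply/outersC23/outersC12.
  (* After the exchange [b] still has no neighbour on the path and is adjacent to [a], now a twin of
     0: the earlier case with [b] in the role of [a]. *)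
  by apply: (good_iso_first frS oS cb' ta'); rewrite (fr_sym frS) eab.
- case: (eqVneq w 1) => [w1|/eqP w1].
    by rewrite w1 in tb; apply: (good_same fr o _ ca tb tc ac); right.
  case: (eqVneq w 0) => [w0|/eqP w0].
    by rewrite w0 in tb; apply: (good_first_second fr (outersC23 o) ca tc tb); rewrite ac.
  exfalso; have cw : g c w = pth 1 w by apply: tc.
  have cbE : g c b = pth 1 w.
    case: (eqVneq w (q + 8)) => [w8|/eqP w8].
      apply/eqP/negPn/negP => /eqP ne; rewrite w8 in tb.
      have ne' : g b c <> pth (q + 8) 1 by rewrite sg pthC -w8.
      by have := tw_last_inner fr ob oc nbc i1 tb tc ne'; lia.
    have wi : 0 < w < q + 8 by lia.
    exact: (tw_tw_inner fr oc ob ncb i1 wi (not_eq_sym w1) tc tb).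
  case abE: (g a b); last first.
    by apply: (frame_twin fr o w9 tb); rewrite ?abE ?ca // cbE cw.
  have tb' : tw q (relabel (swap 1 c) g) w b.
    move=> i i9 ii; case: (eqVneq i 1) => [->|/eqP iw].
      by rewrite (relabel_swap_in g oc i1 ob nbc) sg cbE pthC.
    by rewrite (relabel_swap_path g oc i1 ob nbc) // tb.
  case: (eqVneq w (q + 8)) => [w8|/eqP w8].
    rewrite w8 in tb'.
    by have := first_last frS oa ob oc nab nac nbc ta' tb'; rewrite eab abE.
  have wi : 0 < w < q + 8 by lia.
  have ne : relabel (swap 1 c) g a b <> pth 0 w by rewrite eab abE /pth; lia.
  by have [/w1] := tw_first_inner frS oa ob nab wi ta' tb' ne.
Qed.

(** A boolean form of [tw], so that the twins of [u] can be collected into a [pred nat] serving as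
    an interval. *)
Definition twb q (g : rel nat) u z :=
  all (fun i => (i == u) || (g z i == pth u i)) (iota 0 (q + 9)).

Lemma twP q g u z : reflect (tw q g u z) (twb q g u z).
Proof.
apply: (iffP allP) => [h i i9 /eqP/negbTE iu|h i].
  by have := h i; rewrite mem_iota iu /= => /(_ i9)/eqP.
rewrite mem_iota => i9; case: eqVneq => //= /eqP iu.
by rewrite h // -[_ < _]/(i < q + 9).
Qed.

(* a and c do not have the adjacency that their types force when the subgraph on the path, a and c
   is decomposable. *)
Definition unexpected q g a c : Prop :=
  (exists b u, [/\ u < q + 9, const_on q g b a, tw q g u c & g a c <> b]) \/
  (exists u w, [/\ u < q + 9, w < q + 9, u <> w & [/\ tw q g u a, tw q g w c & g a c <> pth u w]]).

(* Otherwise an outer twin of u together with u and its other twins, or the path itself, is an interval. *)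
Lemma has_unexpected q g : frame q g ->
  exists a c, [/\ outer q a, outer q c, a <> c & unexpected q g a c].
Proof.
move=> fr; apply: NNPP => nu.
have sg := fr_sym fr.
case: (classic (exists z u, [/\ outer q z, u < q + 9 & tw q g u z])) => [[z [u [oz u9 tz]]]|nt].
- pose I i := (i == u) || (outer q i && twb q g u i).
  have In i : I i -> i < q + 12 by move=> /orP[/eqP->|/andP[/andP[]]] //; lia.
  have Iu : I u by rewrite /I eqxx.
  have Iz : I z by rewrite /I oz; case: twP => //; rewrite orbT.
  have uz : u <> z by move: oz; rewrite /outer; lia.
  have [k [k9 ku]] : exists k, k < q + 9 /\ k <> u.
    by case: u {I In Iu Iz uz tz u9} => [|u]; [exists 1|exists 0]; lia.
  have kn : k < q + 12 by lia.
  have nIk : ~~ I k by rewrite /I negb_or; apply/andP; split; [apply/eqP|rewrite /outer; lia].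
  apply: (frame_interval fr In Iu Iz uz kn nIk) => v.
  suff H i : v < q + 12 -> ~~ I v -> I i -> g v i = g v u.
    by move=> i j vn nv Ii Ij; rewrite !H.
  move=> vn; rewrite {1}/I negb_or => /andP[/eqP vu nv] /orP[/eqP->//|/andP[oi /twP ti]].
  have [v9|v9] := ltnP v (q + 9).
    by rewrite sg ti // (fr_path fr) // pthC.
  have ov : outer q v by rewrite /outer v9.
  have vi : v <> i by move=> e; move: nv; rewrite e oi; case: twP.
  apply: NNPP => ne; apply: nu; exists v, i; split=> //.
  case: (typed fr ov) => [[b cv]|[w w9 tv]]; [left|right].
    by exists b, u; split=> //; move: ne; rewrite (cv u).
  have wu : w <> u by move=> e; move: nv; rewrite ov -e; case: twP.
  by exists w, u; split=> //; split=> // e; apply: ne; rewrite e tv //; apply: not_eq_sym.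
- have h0 : 0 < q + 9 by lia.
  have h1 : 1 < q + 9 by lia.
  have kn : q + 9 < q + 12 by lia.
  have nk : ~~ (q + 9 < q + 9) by rewrite ltnn.
  have In i : i < q + 9 -> i < q + 12 by lia.
  apply: (frame_interval (I := fun i => i < q + 9) fr In h0 h1 _ kn nk) => // v i j vn.
  rewrite -leqNgt => v9 i9 j9; have ov : outer q v by rewrite /outer v9.
  case: (typed fr ov) => [[b cv]|[w w9 tv]]; first by rewrite !cv.
  by case: nt; exists v, w.
Qed.

Lemma third q a c : outer q a -> outer q c -> a <> c -> exists b, outers q a b c.
Proof.
move=> oa oc ac.
have [b [ob ab bc]] : exists b, [/\ outer q b, a <> b & b <> c].
  move: (oa) (oc); rewrite /outer => ha hc.
  have [|[|]] : (a <> q + 9 /\ c <> q + 9) \/ (a <> q + 10 /\ c <> q + 10) \/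
    (a <> q + 11 /\ c <> q + 11) by lia.
  - by case=> ? ?; exists (q + 9); split=> //; [lia|apply: not_eq_sym].
  - by case=> ? ?; exists (q + 10); split=> //; [lia|apply: not_eq_sym].
  - by case=> ? ?; exists (q + 11); split=> //; [lia|apply: not_eq_sym].
by exists b; split.
Qed.

Lemma good_mirror q g : good q (relabel (mirror q) g) -> good q g.
Proof. exact: (good_relabel (@mirrorK q) (@mirror_lt q)). Qed.

(** What survives is [w = 1] with [a] adjacent to neither 0 nor [c]. Exchanging 1 and [c] then
    leaves [a] without neighbours on the path but adjacent to the new outer twin of 1. *)
Lemma good_first_unexpected q g w a c : frame q g -> outer q a -> outer q c -> a <> c ->
  0 < w < q + 9 -> tw q g 0 a -> tw q g w c -> g a c <> pth 0 w -> good q g.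
Proof.
move=> fr oa oc ac w9 ta tc ne.
have [b o] := third oa oc ac; have [_ ob _ [ab _ bc]] := o.
have [w8|/eqP w8] := eqVneq w (q + 8).
  rewrite w8 in tc ne; case: ne.
  rewrite (first_last fr oa oc ob ac ab (not_eq_sym bc) ta tc) /pth; lia.
have wi : 0 < w < q + 8 by lia.
have [w1 a0] := tw_first_inner fr oa oc ac wi ta tc ne.
subst w.
have frS := swap_frame fr oc wi tc.
have acE : g a c = false by case: (g a c) ne.
apply: (good_relabel (swapK 1 c)).
  by move=> i; move: oc; rewrite /swap /outer; case: eqP => [->|_]; [lia|case: eqP => [->|]; lia].
apply: (good_iso_second frS o _ (relabel_swap_tw fr oc wi)).
  move=> i i9; case: (eqVneq i 1) => [->|/eqP i1].
    by rewrite (relabel_swap_in g oc wi oa ac).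
  rewrite (relabel_swap_path g oc wi oa ac) //.
  by case: (eqVneq i 0) => [->//|/eqP i0]; rewrite ta // /pth; lia.
by rewrite (relabel_swap_out g oc wi oa ac) ta //; lia.
Qed.

Lemma frame_good q g : frame q g -> good q g.
Proof.
move=> fr; have [a [c [oa oc ac un]]] := has_unexpected fr.
have frR := mirror_frame fr; have sg := fr_sym fr.
have q8 : q + 8 < q + 9 by lia.
have [b o] := third oa oc ac; have [_ ob _ [ab _ bc]] := o.
have ca := not_eq_sym ac.
have eac := mirror_edge g oa oc.
case: un => [[[] [u [u9 cta tc ne]]]|[u [w [u9 w9 uw [ta tc ne]]]]].
(* A vertex joined to the whole path is adjacent to every outer twin: by [all_first], possibly
   reversed, for the ends and by [const_inner] for inner vertices. *)
- exfalso; have [u0|/eqP u0] := eqVneq u 0.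
    rewrite u0 in tc; apply: ne; rewrite sg.
    exact: (all_first fr oc oa ob ca (not_eq_sym bc) ab tc cta).
  have [u8|/eqP u8] := eqVneq u (q + 8).
    rewrite u8 in tc; have := mirror_tw oc q8 tc; rewrite subnn => tc'.
    have := all_first frR oc oa ob ca (not_eq_sym bc) ab tc' (mirror_const oa cta).
    by rewrite mirror_edge // sg => /ne.
  have ui : 0 < u < q + 8 by lia.
  by have [] := const_inner fr oc oa ca ui tc cta ne.
- have acT : g a c by case: (g a c) ne.
  have [u0|/eqP u0] := eqVneq u 0.
    by rewrite u0 in tc; apply: (good_iso_first fr o cta tc acT).
  have [u8|/eqP u8] := eqVneq u (q + 8).
    rewrite u8 in tc; have := mirror_tw oc q8 tc; rewrite subnn => tc'.
    by apply/good_mirror; apply: (good_iso_first frR o (mirror_const oa cta) tc'); rewrite eac.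
  have ui : 0 < u < q + 8 by lia.
  have [_ [u1|u7]] := const_inner fr oc oa ca ui tc cta ne.
    by rewrite u1 in tc; apply: (good_iso_second fr o cta tc acT).
  have := mirror_tw oc u9 tc; have -> : q + 8 - u = 1 by lia.
  move=> tc'; apply/good_mirror.
  by apply: (good_iso_second frR o (mirror_const oa cta) tc'); rewrite eac.
- have ne' : g c a <> pth w u by rewrite sg pthC.
  have neR : relabel (mirror q) g a c <> pth (q + 8 - u) (q + 8 - w).
    by rewrite eac; move: ne; rewrite /pth; lia.
  have neR' : relabel (mirror q) g c a <> pth (q + 8 - w) (q + 8 - u).
    by rewrite (fr_sym frR) pthC.
  have [u0|/eqP u0] := eqVneq u 0.
    have w0 : 0 < w < q + 9 by lia.
    by rewrite u0 in ta ne; apply: (good_first_unexpected fr oa oc ac w0 ta tc ne).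
  have [w0|/eqP w0] := eqVneq w 0.
    have u0' : 0 < u < q + 9 by lia.
    by rewrite w0 in tc ne'; apply: (good_first_unexpected fr oc oa ca u0' tc ta ne').
  have [u8|/eqP u8] := eqVneq u (q + 8).
    have := mirror_tw oa u9 ta; have e : q + 8 - u = 0 by lia.
    rewrite e in neR *; move=> ta'; apply: good_mirror.
    by apply: (good_first_unexpected frR oa oc ac _ ta' (mirror_tw oc w9 tc) neR); lia.
  have [w8|/eqP w8] := eqVneq w (q + 8).
    have := mirror_tw oc w9 tc; have e : q + 8 - w = 0 by lia.
    rewrite e in neR' *; move=> tc'; apply: good_mirror.
    by apply: (good_first_unexpected frR oc oa ca _ tc' (mirror_tw oa u9 ta) neR'); lia.
  have ui : 0 < u < q + 8 by lia.
  have wi : 0 < w < q + 8 by lia.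
  by case: ne; apply: (tw_tw_inner fr oa oc ac ui wi uw ta tc).
Qed.

(** * Graphs in normal form are critical *)

Lemma primeOn_no_interval g (Y I : pred nat) i j k : primeOn g Y ->
  (forall i, I i -> Y i) -> I i -> I j -> i <> j -> Y k -> ~~ I k ->
  ~ (forall v i j, Y v -> ~~ I v -> I i -> I j -> g v i = g v j).
Proof.
move=> pY sI Ii Ij ij Yk nIk iI; case: (pY I sI iI) => [sg|al].
  by case: ij; apply: sg.
by rewrite al in nIk.
Qed.

Lemma primeOn_no_twins g (Y : pred nat) i j k : primeOn g Y ->
  Y i -> Y j -> i <> j -> Y k -> k <> i -> k <> j ->
  ~ (forall v, Y v -> v <> i -> v <> j -> g v i = g v j).
Proof.
move=> pY Yi Yj ij Yk ki kj h.
have sI v : (v == i) || (v == j) -> Y v by case/orP => /eqP->.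
have Ii : (i == i) || (i == j) by rewrite eqxx.
have Ij : (j == i) || (j == j) by rewrite eqxx orbT.
have Ik : ~~ ((k == i) || (k == j)) by rewrite negb_or; apply/andP; split; apply/eqP.
apply: (primeOn_no_interval pY sI Ii Ij ij Yk Ik) => v s t Yv.
rewrite negb_or => /andP[/eqP vi /eqP vj].
by case/orP=> /eqP-> /orP[] /eqP-> //; rewrite h.
Qed.

Lemma primeOn_no_isolated g (Y : pred nat) i j k : primeOn g Y ->
  Y i -> Y j -> Y k -> i <> j -> k <> i -> k <> j ->
  ~ (forall v, Y v -> v <> k -> g k v = false).
Proof.
move=> pY Yi Yj Yk ij ki kj h.
have sI v : Y v && (v != k) -> Y v by case/andP.
have Ii : Y i && (i != k) by rewrite Yi; apply/eqP/not_eq_sym.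
have Ij : Y j && (j != k) by rewrite Yj; apply/eqP/not_eq_sym.
have Ik : ~~ (Y k && (k != k)) by rewrite eqxx andbF.
apply: (primeOn_no_interval pY sI Ii Ij ij Yk Ik) => v s t Yv.
by rewrite Yv negbK => /eqP-> /andP[Ys /eqP sk] /andP[Yt /eqP tk]; rewrite !h.
Qed.

(** What is known in the converse direction before indecomposability and criticality are
    established. *)
Record pathed q (g : rel nat) : Prop := Pathed {
  pa_sym : symmetric g;
  pa_irr : irreflexive g;
  pa_path : forall i j, i < q + 9 -> j < q + 9 -> g i j = pth i j
}.

Section Configurations.
Variables (q : nat) (g : rel nat).
Hypothesis pg : pathed q g.

Let sg := pa_sym pg.
Let ig := pa_irr pg.
Let P := pa_path pg.

(** The sequence a, c, 1, ..., q + 8 is an induced path; 0 is added last, and [a] separates it from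
    [c]. *)
Lemma prime_iso_first a c : outer q a -> outer q c -> a <> c ->
  const_on q g false a -> tw q g 0 c -> g a c ->
  primeOn g (fun i => (i < q + 9) || (i == a) || (i == c)).
Proof.
rewrite /outer => oa oc nac ca tc ac; have ac' : g c a by rewrite sg.
have p1 : path_set g 1 (q + 8) (fun i => 0 < i < q + 9).
  by apply: path_set_up => i; [move=> j *; apply: P|]; alia.
have p2 : path_set g c (q + 8).+1 (fun i => (0 < i < q + 9) || (i == c)).
  apply: (path_set_cons sg ig p1) => //=; try alia.
  by move=> i Yi; move: (tc i); rewrite /pth; alia.
have p3 : path_set g a (q + 8).+2 (fun i => (0 < i < q + 9) || (i == c) || (i == a)).
  apply: (path_set_cons sg ig p2) => //=; try alia.
  move=> i /orP[Yi|/eqP->]; last by rewrite ac eqxx.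
  by move: (ca i); alia.
have k4 : 4 <= (q + 8).+2 by alia.
have {p1 p2 p3 k4} r1 := path_set_prime k4 p3.
apply: (primeOn_ext (v := 0) sg r1) => [|i|b h|u /orP[/orP[Yu|/eqP ->]|/eqP ->] h] //=; try alia.
- by move: (h 2) (h 1) (P (i := 0) (j := 2)) (P (i := 0) (j := 1)); rewrite /pth; alia.
- have {}h w : 0 < w < q + 9 -> w <> u -> pth 0 w = pth u w.
    by move=> w1 w2; move: (h w) (P (i := 0) (j := w)) (P (i := u) (j := w)); alia.
  by move: (h 1) (h 2) (h 3); rewrite /pth; alia.
- by move: (h a) (ca 0) ac'; rewrite (sg 0 a); alia.
- by move: (h 1) (P (i := 0) (j := 1)) (ca 1); rewrite /pth; alia.
Qed.

(** The sequence a, b, 2, ..., q + 8 is an induced path; [a] separates the added vertex 1 from [b],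
    and 0 comes last. *)
Lemma prime_iso_second a b : outer q a -> outer q b -> a <> b ->
  const_on q g false a -> tw q g 1 b -> g a b ->
  primeOn g (fun i => (i < q + 9) || (i == a) || (i == b)).
Proof.
rewrite /outer => oa ob nab ca tb ab; have ab' : g b a by rewrite sg.
have p1 : path_set g 2 (q + 7) (fun i => 1 < i < q + 9).
  by apply: path_set_up => i; [move=> j *; apply: P|]; alia.
have p2 : path_set g b (q + 7).+1 (fun i => (1 < i < q + 9) || (i == b)).
  apply: (path_set_cons sg ig p1) => //=; try alia.
  by move=> i Yi; move: (tb i); rewrite /pth; alia.
have p3 : path_set g a (q + 7).+2 (fun i => (1 < i < q + 9) || (i == b) || (i == a)).
  apply: (path_set_cons sg ig p2) => //=; try alia.
  move=> i /orP[Yi|/eqP->]; last by rewrite ab eqxx.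
  by move: (ca i); alia.
have k4 : 4 <= (q + 7).+2 by alia.
have {p1 p2 p3 k4} r1 := path_set_prime k4 p3.
have r2 : primeOn g (fun i => (0 < i < q + 9) || (i == a) || (i == b)).
  apply: (primeOn_ext (v := 1) sg r1) => [|i|d h|u /orP[/orP[Yu|/eqP ->]|/eqP ->] h] //=; try alia.
  - by move: (h 2) (h 4) (P (i := 1) (j := 2)) (P (i := 1) (j := 4)); rewrite /pth; alia.
  - have {}h w : 1 < w < q + 9 -> w <> u -> pth 1 w = pth u w.
      by move=> w1 w2; move: (h w) (P (i := 1) (j := w)) (P (i := u) (j := w)); alia.
    by move: (h 2) (h 3) (h 4); rewrite /pth; alia.
  - by move: (h a) (ca 1) ab'; rewrite (sg 1 a); alia.
  - by move: (h 2) (P (i := 1) (j := 2)) (ca 2); rewrite /pth; alia.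
apply: (primeOn_ext (v := 0) sg r2) => [|i|d h|u /orP[/orP[Yu|/eqP ->]|/eqP ->] h] //=; try alia.
- by move: (h 2) (h 1) (P (i := 0) (j := 2)) (P (i := 0) (j := 1)); rewrite /pth; alia.
- have {}h w : 0 < w < q + 9 -> w <> u -> pth 0 w = pth u w.
    by move=> w1 w2; move: (h w) (P (i := 0) (j := w)) (P (i := u) (j := w)); alia.
  by move: (h 1) (h 2) (h 3); rewrite /pth; alia.
- by move: (h 1) (P (i := 0) (j := 1)) (ca 1); rewrite /pth; alia.
- by move: (h a) (ca 0) ab'; rewrite (sg 0 a); alia.
Qed.

(** The sequence c, 1, ..., q + 8 is an induced path; [c] separates the added vertex [b] from 1, and
    [b] then separates 0 from [c]. *)
Lemma prime_first_second b c : outer q b -> outer q c -> b <> c ->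
  tw q g 1 b -> tw q g 0 c -> ~~ g b c ->
  primeOn g (fun i => (i < q + 9) || (i == b) || (i == c)).
Proof.
rewrite /outer => ob oc nbc tb tc bc; have cb : ~~ g c b by rewrite sg.
have p1 : path_set g 1 (q + 8) (fun i => 0 < i < q + 9).
  by apply: path_set_up => i; [move=> j *; apply: P|]; alia.
have p2 : path_set g c (q + 8).+1 (fun i => (0 < i < q + 9) || (i == c)).
  apply: (path_set_cons sg ig p1) => //=; try alia.
  by move=> i Yi; move: (tc i); rewrite /pth; alia.
have k4 : 4 <= (q + 8).+1 by alia.
have {p1 p2 k4} r1 := path_set_prime k4 p2.
have r2 : primeOn g (fun i => (0 < i < q + 9) || (i == c) || (i == b)).
  apply: (primeOn_ext (v := b) sg r1) => [|i|d h|u /orP[Yu|/eqP ->] h] //=; try alia.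
  - by move: (h 2) (h 4) (tb 2) (tb 4); rewrite /pth; alia.
  - case: (eqVneq u 1) => [e|u1].
      by subst; move: (h c) (tc 1) bc; rewrite (sg 1 c) /pth; alia.
    have {}h w : 1 < w < q + 9 -> w <> u -> pth 1 w = pth u w.
      by move=> w1 w2; move: (h w) (tb w) (P (i := u) (j := w)); alia.
    by move: (h 2) (h 3) (h 4); rewrite /pth; alia.
  - by move: (h 2) (tb 2) (tc 2); rewrite /pth; alia.
apply: (primeOn_ext (v := 0) sg r2) => [|i|d h|u /orP[/orP[Yu|/eqP ->]|/eqP ->] h] //=; try alia.
- by move: (h 2) (h 1) (P (i := 0) (j := 2)) (P (i := 0) (j := 1)); rewrite /pth; alia.
- have {}h w : 0 < w < q + 9 -> w <> u -> pth 0 w = pth u w.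
    by move=> w1 w2; move: (h w) (P (i := 0) (j := w)) (P (i := u) (j := w)); alia.
  by move: (h 1) (h 2) (h 3); rewrite /pth; alia.
- by move: (h b) (tb 0) cb; rewrite (sg 0 b) /pth; alia.
- by move: (h 2) (P (i := 0) (j := 2)) (tb 2); rewrite /pth; alia.
Qed.

(** A twin of [u] over the path can only be confused with [u], [x] or [y]; the last three hypotheses
    separate it from these in turn. *)
Lemma prime_ext_tw u x y z : outers q x y z -> u = 0 \/ u = 1 -> tw q g u z ->
  primeOn g (fun i => (i < q + 9) || (i == x) || (i == y)) ->
  g z x <> g u x \/ g z y <> g u y ->
  (exists w, (w < q + 9 \/ w = y) /\ g z w <> g x w) ->
  (exists w, (w < q + 9 \/ w = x) /\ g z w <> g y w) ->
  primeOn g (fun i => i < q + 12).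
Proof.
case; rewrite /outer => ox oy oz [xy xz yz] u01 tz r1 s1 [w1 [h1 n1]] [w2 [h2 n2]].
apply: (primeOn_ext (v := z) sg r1) => [|i|d h|v /orP[/orP[Yv|/eqP ->]|/eqP ->] h] //=; try alia.
- by case: u01 => e; subst; move: (h 1) (h 2) (h 0) (h 4) (tz 0) (tz 1) (tz 2) (tz 4); rewrite /pth; alia.
- case: (eqVneq v u) => [e|/eqP vu].
    by subst; case: s1; apply; apply: h; alia.
  have {}h w : w < q + 9 -> w <> u -> w <> v -> pth u w = pth v w.
    by move=> i1 i2 i3; move: (h w) (tz w) (P (i := v) (j := w)); alia.
  by case: u01 => e; subst; move: (h 0) (h 1) (h 2) (h 3); rewrite /pth; alia.
- by apply: n1; apply: h; alia.
- by apply: n2; apply: h; alia.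
Qed.

Lemma prime_ext_iso x y z : outers q x y z -> const_on q g false z ->
  primeOn g (fun i => (i < q + 9) || (i == x) || (i == y)) ->
  g z x -> g x y -> ~~ g z y -> tw q g 0 y ->
  primeOn g (fun i => i < q + 12).
Proof.
case; rewrite /outer => ox oy oz [xy xz yz] cz r1 zx xyT zy ty.
apply: (primeOn_ext (v := z) sg r1) => [|i|d h|v /orP[/orP[Yv|/eqP ->]|/eqP ->] h] //=; try alia.
- by move: (h x) (h 0) (cz 0) zx; alia.
- have {}h w : w < q + 9 -> w <> v -> false = pth v w.
    by move=> i1 i2; move: (h w) (cz w) (P (i := v) (j := w)); alia.
  by case: v Yv h => [|v] Yv h; [move: (h 1)|move: (h v)]; rewrite /pth; alia.
- by move: (h y) zy xyT; alia.
- by move: (h 1) (cz 1) (ty 1); rewrite /pth; alia.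
Qed.

(** An edge of G_X together with the path is indecomposable; the remaining conditions of the
    configuration separate the third vertex from everything else. *)
Lemma cfg_prime a b c : outers q a b c -> cfg q g a b c -> primeOn g (fun i => i < q + 12).
Proof.
move=> o; have [oa ob oc [nab nac nbc]] := o.
have nca := not_eq_sym nac; have ncb := not_eq_sym nbc; have nba := not_eq_sym nab.
have [q0 q1] : 0 < q + 9 /\ 1 < q + 9 by lia.
have q2 : 2 < q + 9 by lia.
case=> [[ca cb tc [bc ac ab]]|[ca tb tc two n0]|[u [u01 ca tb tc h]]].
- have o' : outers q b c a by apply/outersC23/outersC12.
  by apply: (prime_ext_iso o' ca (prime_iso_first ob oc nbc cb tc bc) ab bc ac tc).
- have oacb := outersC23 o.
  (* This covers the two choices of two edges of G_X that include {a, c}. *)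
  have Eb : g a c -> g a b \/ ~~ g b c -> primeOn g (fun i => i < q + 12).
    move=> ac h; apply: (prime_ext_tw oacb _ tb (prime_iso_first oa oc nac ca tc ac)).
    + by right.
    + case: h => h; [left|right]; first by rewrite sg h sg ca.
      by rewrite (negbTE h) sg tc.
    + by exists 0; split; [left|rewrite tb ?ca].
    + by exists 2; split; [left|rewrite tb ?tc].
  case/or3P: two => /andP[h1 h2].
  + by apply: Eb; [|left].
  + apply: (prime_ext_tw o _ tc (prime_iso_second oa ob nab ca tb h1)).
    * by left.
    * by right; rewrite sg (negbTE h2) sg tb.
    * by exists 1; split; [left|rewrite tc ?ca].
    * by exists 2; split; [left|rewrite tb ?tc].
  + by apply: Eb; [|right].
- have [u9 [w [w9 wu wt]]] : u < q + 9 /\ exists w, [/\ w < q + 9, w <> u & pth u w].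
    by case: u01 => ->; split=> //; [exists 1|exists 0].
  have ac : g a c by case/orP: h => /and3P[].
  have pr : primeOn g (fun i => (i < q + 9) || (i == a) || (i == c)).
    by case: u01 => e; subst; [apply: prime_iso_first|apply: prime_iso_second].
  apply: (prime_ext_tw (outersC23 o) u01 tb pr).
  + case/orP: h => /and3P[h1 _ /eqP h3]; [left|right].
      by rewrite sg h1 sg ca.
    by rewrite sg (sg u).
  + by exists w; split; [left|rewrite tb // ca // wt].
  + case/orP: h => /and3P[h1 _ /eqP h3]; first by exists u; split; [left|].
    by exists a; split; [right|rewrite sg (negbTE h1) sg ac].
Qed.

(** * Intervals that appear after a deletion *)

Lemma cut_two_outer x y z : outers q x y z ->
  (exists b, const_on q g b z) \/ (exists2 u, u < q + 9 & tw q g u z) ->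
  ~ primeOn g (fun i => [&& i < q + 12, i != x & i != y]).
Proof.
case; rewrite /outer => ox oy oz [xy xz yz] [[b cz]|[u u9 tz]] pY.
- have sI i : i < q + 9 -> [&& i < q + 12, i != x & i != y] by alia.
  have [h0 h1] : 0 < q + 9 /\ 1 < q + 9 by alia.
  have Yz : [&& z < q + 12, z != x & z != y] by alia.
  have nz : ~~ (z < q + 9) by alia.
  apply: (primeOn_no_interval (I := fun i => i < q + 9) pY sI h0 h1 _ Yz nz) => // v i j Yv nv i9 j9.
  have -> : v = z by alia.
  by rewrite !cz.
- have [k [k9 ku]] : exists k, k < q + 9 /\ k <> u.
    by case: u {tz} u9 => [|u] u9; [exists 1|exists 0]; alia.
  apply: (@primeOn_no_twins _ _ u z k pY); try alia.
  move=> v Yv vu vz; have v9 : v < q + 9 by alia.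
  by rewrite (sg v z) tz // P // pthC.
Qed.

(** Once [x] is gone, path vertices above [x] are adjacent to nothing outside that tail, so the
    remaining vertices form an interval. It misses q + 8, which survives the deletion. *)
Lemma cut_tail x y : 1 < x < q + 8 -> y < q + 12 -> y <> x -> y <> 0 -> y <> q + 8 ->
  (forall z v, outer q z -> 2 < v < q + 9 -> g z v = false) ->
  ~ primeOn g (fun i => [&& i < q + 12, i != x & i != y]).
Proof.
move=> xi yn yx y0 y8 hz pY.
pose Y i := [&& i < q + 12, i != x & i != y].
pose I i := Y i && ~~ (x < i < q + 9).
have sI i : I i -> Y i by case/andP.
have I0 : I 0 by rewrite /I /Y; alia.
(* A second element of the interval: 1, unless it is the other deleted vertex. *)
have [j [j0 Ij]] : exists j, 0 <> j /\ I j.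
  by rewrite /I /Y; case: (eqVneq y 1) => ?; [exists (q + 9)|exists 1]; alia.
have Yk : Y (q + 8) by rewrite /Y; alia.
have nIk : ~~ I (q + 8) by rewrite /I /Y; alia.
apply: (primeOn_no_interval pY sI I0 Ij j0 Yk nIk) => v.
suff H i : Y v -> ~~ I v -> I i -> g v i = false.
  by move=> s t Yv nv Is It; rewrite !H.
move=> Yv; rewrite /I negb_and Yv /= negbK => vx /andP[Yi ni].
have [i9|i9] := ltnP i (q + 9).
  by move: (P (i := v) (j := i)); rewrite /pth; move: Yi ni; rewrite /Y; alia.
by rewrite sg hz //; rewrite /outer; move: Yi vx xi i9; rewrite /Y; alia.
Qed.

(** Deleting 1 disconnects 0, z, t from the rest of the path. *)
Lemma cut_second y z t : outers q y z t ->
  (forall v, 1 < v < q + 9 -> g z v = false /\ g t v = false) ->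
  ~ primeOn g (fun i => [&& i < q + 12, i != 1 & i != y]).
Proof.
case; rewrite /outer => oy oz ot [yz yt zt] h pY.
pose Y i := [&& i < q + 12, i != 1 & i != y].
pose I i := Y i && ~~ (1 < i < q + 9).
have sI i : I i -> Y i by case/andP.
have I0 : I 0 by rewrite /I /Y; alia.
have Iz : I z by rewrite /I /Y; alia.
have z0 : 0 <> z by alia.
have Yk : Y (q + 8) by rewrite /Y; alia.
have nIk : ~~ I (q + 8) by rewrite /I /Y; alia.
apply: (primeOn_no_interval pY sI I0 Iz z0 Yk nIk) => v.
suff H i : Y v -> ~~ I v -> I i -> g v i = false.
  by move=> i j Yv nv Ii Ij; rewrite !H.
move=> Yv; rewrite /I negb_and Yv /= negbK => vx /andP[Yi ni].
have [h1 h2] := h v vx.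
have [e|[e|e]] : i = 0 \/ i = z \/ i = t by move: Yi ni; rewrite /Y; alia.
- by subst; move: (P (i := v) (j := 0)); rewrite /pth; alia.
- by subst; rewrite sg.
- by subst; rewrite sg.
Qed.

(** Without 1, the only possible neighbour of 0 or of [a] is [b], and 0 is adjacent to it. So 0 and
    [a] are twins, or [a] is isolated. *)
Lemma cut_second_iso y a b : outers q y a b -> const_on q g false a -> tw q g 1 b ->
  ~ primeOn g (fun i => [&& i < q + 12, i != 1 & i != y]).
Proof.
case; rewrite /outer => oy oa ob [ya yb ab] ca tb pY.
have q0 : 0 < q + 9 by alia.
case abE: (g a b).
- apply: (@primeOn_no_twins _ _ 0 a (q + 8) pY); try alia.
  move=> v Yv v0 va; have [v9|v9] := ltnP v (q + 9).
    by rewrite (sg v a) ca //; move: (P (i := v) (j := 0)); rewrite /pth; alia.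
  have -> : v = b by alia.
  by rewrite (sg b a) abE tb.
- apply: (@primeOn_no_isolated _ _ 0 (q + 8) a pY); try alia.
  move=> v Yv va; have [v9|v9] := ltnP v (q + 9); first exact: ca.
  by have -> : v = b by alia.
Qed.

(** Without 1, the vertices 0 and [c] have only [b] and possibly each other as neighbours, and 0 is
    adjacent to [b]. If [c] is too, they are twins; if not, the last condition of (ii) makes [c]
    isolated. *)
Lemma cut_second_first y b c : outers q y b c -> tw q g 1 b -> tw q g 0 c ->
  (~~ g b c -> g c 0 = false) ->
  ~ primeOn g (fun i => [&& i < q + 12, i != 1 & i != y]).
Proof.
case; rewrite /outer => oy ob oc [yb yc bc] tb tc n0 pY.
have q0 : 0 < q + 9 by alia.
case bcE: (g b c) n0 => /= n0.
- apply: (@primeOn_no_twins _ _ 0 c (q + 8) pY); try alia.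
  move=> v Yv v0 va; have [v9|v9] := ltnP v (q + 9).
    by rewrite (sg v c); move: (tc v) (P (i := v) (j := 0)); rewrite /pth; alia.
  have -> : v = b by alia.
  by rewrite bcE tb.
- apply: (@primeOn_no_isolated _ _ 0 (q + 8) c pY); try alia.
  move=> v Yv va; have [v9|v9] := ltnP v (q + 9).
    by case: (eqVneq v 0) => [->|]; [rewrite n0|move: (tc v); rewrite /pth; alia].
  have -> : v = b by alia.
  by rewrite sg.
Qed.

Lemma cut_second_same y b c : outers q y b c -> tw q g 1 b -> tw q g 1 c ->
  ~ primeOn g (fun i => [&& i < q + 12, i != 1 & i != y]).
Proof.
case; rewrite /outer => oy ob oc [yb yc bc] tb tc pY.
apply: (@primeOn_no_twins _ _ b c 0 pY); try alia.
move=> v Yv vb vc; have v9 : v < q + 9 by alia.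
by rewrite !(sg v) tb ?tc; alia.
Qed.

Lemma cfg_cut_second a b c y : outers q a b c -> cfg q g a b c -> outer q y ->
  ~ primeOn g (fun i => [&& i < q + 12, i != 1 & i != y]).
Proof.
move=> o h oy; have oacb := outersC23 o; have obac := outersC12 o.
have obca := outersC23 obac; have ocab : outers q c a b by apply/outersC12/outersC23.
have ocba := outersC23 ocab.
have Hc x v : const_on q g false x -> 1 < v < q + 9 -> g x v = false.
  by move=> cx hv; rewrite cx //; lia.
have Ht x v : tw q g 0 x -> 1 < v < q + 9 -> g x v = false.
  by move=> tx hv; move: (tx v); rewrite /pth; lia.
have hy : y < q + 12 by case/andP: oy.
have {hy} : [\/ y = a, y = b | y = c].
  case: (outersP o hy) => [|->|->|->]; [by move: oy; rewrite /outer; lia|..].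
  - by constructor 1.
  - by constructor 2.
  - by constructor 3.
case: h => [[ca cb tc _]|[ca tb tc _ n0]|[u [[] u01 ca tb tc _]]]; case=> {oy}->.
- by apply: (cut_second o) => v hv; rewrite Hc // Ht.
- by apply: (cut_second obac) => v hv; rewrite Hc // Ht.
- by apply: (cut_second ocab) => v hv; rewrite Hc // Hc.
- exact: (cut_second_first o tb tc n0).
- by apply: (cut_second obac) => v hv; rewrite Hc // Ht.
- exact: (cut_second_iso ocab ca tb).
- by rewrite u01 in tb tc; apply: (cut_second o) => v hv; rewrite !Ht.
- by rewrite u01 in tb tc; apply: (cut_second obac) => v hv; rewrite Hc // Ht.
- by rewrite u01 in tb tc; apply: (cut_second ocab) => v hv; rewrite Hc // Ht.
- by rewrite u01 in tb tc; apply: (cut_second_same o tb tc).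
- by rewrite u01 in tb tc; apply: (cut_second_iso obac ca tc).
- by rewrite u01 in tb tc; apply: (cut_second_iso ocab ca tb).
Qed.

Lemma cfg_typed a b c z : outers q a b c -> cfg q g a b c -> outer q z ->
  const_on q g false z \/ exists2 u, u < 2 & tw q g u z.
Proof.
move=> o h oz; have hz : z < q + 12 by case/andP: oz.
have {hz} : [\/ z = a, z = b | z = c].
  case: (outersP o hz) => [|->|->|->]; [by move: oz; rewrite /outer; lia|..].
  - by constructor 1.
  - by constructor 2.
  - by constructor 3.
case: h => [[ca cb tc _]|[ca tb tc _ _]|[u [u01 ca tb tc _]]]; case=> ->; try (by left); right.
- by exists 0.
- by exists 1.
- by exists 0.
- by exists u => //; case: u01 => ->.
- by exists u => //; case: u01 => ->.
Qed.

Lemma cfg_critical a b c : outers q a b c -> cfg q g a b c -> critical q g.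
Proof.
move=> o h x y xn yn xy x0 x8 y0 y8.
have C x' y' : primeOn g (fun i => [&& i < q + 12, i != x' & i != y']) ->
    primeOn g (fun i => [&& i < q + 12, i != y' & i != x']).
  by apply: eq_primeOn => // i; rewrite [(i != x') && _]andbC.
have T z v : outer q z -> 2 < v < q + 9 -> g z v = false.
  move=> oz hv; case: (cfg_typed o h oz) => [cz|[u u2 tz]]; first by apply: cz; lia.
  by rewrite tz /pth; lia.
have [x2|x2] := boolP (1 < x < q + 8); first by apply: cut_tail => //; apply: not_eq_sym.
have [y2|y2] := boolP (1 < y < q + 8); first by move=> /C; apply: cut_tail.
have [x1|/eqP x1] := eqVneq x 1.
  by rewrite x1 in xy *; apply: (cfg_cut_second o h); rewrite /outer; lia.
have [y1|/eqP y1] := eqVneq y 1.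
  by rewrite y1 in xy *; move=> /C; apply: (cfg_cut_second o h); rewrite /outer; lia.
have ox : outer q x by rewrite /outer; lia.
have oy : outer q y by rewrite /outer; lia.
have [z o'] := third ox oy xy; have [_ oz _ _] := o'.
apply: (cut_two_outer (outersC23 o')).
case: (cfg_typed o h oz) => [cz|[u u2 tz]]; [left|right]; first by exists false.
by exists u => //; lia.
Qed.

Lemma cfg_frame a b c : outers q a b c -> cfg q g a b c -> frame q g.
Proof.
by move=> o h; split=> //; [apply: (cfg_prime o h)|apply: (cfg_critical o h)].
Qed.

End Configurations.

(** * Translation to graphs on ordinals *)

Lemma simP (V : finType) (G : sgraph V) v (I : {set V}) :
  reflect (forall i j, i \in I -> j \in I -> G v i = G v j) (sim G v I).
Proof.
apply: (iffP orP) => [[/forall_inP h|/forall_inP h] i j Ii Ij|h].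
- by rewrite !h.
- by rewrite (negbTE (h i Ii)) (negbTE (h j Ij)).
case: (boolP [exists y in I, G v y]) => [/exists_inP[y Iy vy]|/exists_inPn nE].
  by left; apply/forall_inP => z Iz; rewrite (h z y).
by right; apply/forall_inP.
Qed.

Lemma intervalP (V : finType) (G : sgraph V) (I : {set V}) :
  reflect (forall v i j, v \notin I -> i \in I -> j \in I -> G v i = G v j) (interval G I).
Proof.
apply: (iffP forallP) => [h v i j nv|h v].
  by move/implyP: (h v) => /(_ nv)/simP; apply.
by apply/implyP => nv; apply/simP => i j; apply: h.
Qed.

Lemma trivial_setP (V : finType) (I : {set V}) :
  reflect ((forall x y, x \in I -> y \in I -> x = y) \/ (forall x, x \in I)) (trivial_set I).
Proof.
apply: (iffP or3P) => [[/eqP->|/eqP->|/existsP[x /eqP->]]|[h|h]].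
- by left=> x y; rewrite inE.
- by right=> x; rewrite inE.
- by left=> y z; rewrite !inE => /eqP-> /eqP->.
- have [->|[x Ix]] := set_0Vmem I; first by constructor 1.
  constructor 3; apply/existsP; exists x; apply/eqP/setP => y; rewrite inE.
  by apply/idP/eqP => [Iy|->//]; apply: h.
- by constructor 2; apply/eqP/setP => x; rewrite h inE.
Qed.

(** The injection [r] identifies vertex sets with predicates on its image. It serves both the whole
    graph and induced subgraphs, where it unwraps the subtypes. *)
Lemma indecomposable_primeOn (W : finType) (K : sgraph W) (r : W -> nat) g (Y : pred nat) :
  injective r -> (forall x y, K x y = g (r x) (r y)) ->
  (forall x, Y (r x)) -> (forall i, Y i -> exists x, r x = i) ->
  (indecomposable K <-> primeOn g Y).
Proof.
move=> rI gE rY rS; split=> [/forallP ind I sIY iI|pr].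
- have inJ x : (x \in [set x | I (r x)]) = I (r x) by rewrite inE.
  have /implyP/(_ _)/trivial_setP := ind [set x | I (r x)].
  case=> [|h|h].
  + apply/intervalP => v i j; rewrite !inJ !gE; exact: iI.
  + left=> i j Ii Ij; have [x xi] := rS i (sIY i Ii); have [y yj] := rS j (sIY j Ij).
    by rewrite -xi -yj (h x y) // inJ ?xi ?yj.
  + by right=> i /rS[x <-]; rewrite -inJ.
- apply/forallP => J; apply/implyP => /intervalP iJ; apply/trivial_setP.
  pose I i := [exists x in J, r x == i].
  have IE x : I (r x) = (x \in J).
    apply/exists_inP/idP => [[y Jy /eqP/rI <-//]|Jx]; by exists x.
  case: (pr I) => [i /exists_inP[x _ /eqP <-]//|v i j Yv nIv|sg|al].
  + move=> /exists_inP[x Jx /eqP <-] /exists_inP[y Jy /eqP <-].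
    by have [z zv] := rS v Yv; rewrite -zv IE in nIv *; rewrite -!gE; apply: iJ.
  + by left=> x y Jx Jy; apply: rI; apply: sg; rewrite IE.
  + by right=> x; rewrite -IE al.
Qed.

(** If [a] and [c] are not adjacent, nothing separates [u] from its twin [c]; the label 5 witnesses
    that {u, c} is not everything. *)
Lemma primeOn_iso_tw q g u a c : pathed q g -> outer q a -> outer q c -> a <> c ->
  u = 0 \/ u = 1 -> const_on q g false a -> tw q g u c ->
  primeOn g (fun i => (i < q + 9) || (i == a) || (i == c)) <-> g a c.
Proof.
move=> pg oa oc ac u01 ca tc; split=> [pr|acT]; last first.
  by case: u01 => e; subst; [apply: prime_iso_first|apply: prime_iso_second].
move: (oa) (oc); rewrite /outer => oa' oc'.
apply/negPn/negP => /negbTE acE; have u2 : u < 2 by case: u01 => ->.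
apply: (@primeOn_no_twins _ _ u c 5 pr); try alia.
move=> v Yv vu vc; have [v9|v9] := ltnP v (q + 9).
  by rewrite (pa_path pg) ?(pa_sym pg v c) ?tc 1?pthC //; alia.
have -> : v = a by alia.
by rewrite acE ca //; alia.
Qed.

(** If [b] and [c] are adjacent, nothing separates 1 from its twin [b]. *)
Lemma primeOn_first_second q g b c : pathed q g -> outer q b -> outer q c -> b <> c ->
  tw q g 1 b -> tw q g 0 c ->
  primeOn g (fun i => (i < q + 9) || (i == b) || (i == c)) <-> ~~ g b c.
Proof.
move=> pg ob oc bc tb tc; split=> [pr|]; last exact: prime_first_second.
move: (ob) (oc); rewrite /outer => ob' oc'.
apply/negP => bcT; apply: (@primeOn_no_twins _ _ 1 b 5 pr); try alia.
move=> v Yv v1 vb; have [v9|v9] := ltnP v (q + 9).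
  by rewrite (pa_path pg) ?(pa_sym pg v b) ?tb 1?pthC //; alia.
have -> : v = c by alia.
by rewrite (pa_sym pg c b) bcT tc //; alia.
Qed.

Lemma not_primeOn_iso q g a b : outer q a -> const_on q g false a -> const_on q g false b ->
  ~ primeOn g (fun i => (i < q + 9) || (i == a) || (i == b)).
Proof.
rewrite /outer => oa ca cb pr.
have sI i : i < q + 9 -> (i < q + 9) || (i == a) || (i == b) by move=> ->.
have [h0 h1] : 0 < q + 9 /\ 1 < q + 9 by alia.
have Ya : (a < q + 9) || (a == a) || (a == b) by rewrite eqxx orbT.
have nIa : ~~ (a < q + 9) by alia.
apply: (primeOn_no_interval (I := fun i => i < q + 9) pr sI h0 h1 _ Ya nIa) => // v i j Yv nv i9 j9.
have [->|->] : v = a \/ v = b by alia.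
  by rewrite !ca.
by rewrite !cb.
Qed.

(** Whatever the adjacencies among them, u, b, c form an interval. *)
Lemma not_primeOn_tw q g u b c : pathed q g -> outer q b -> outer q c ->
  u = 0 \/ u = 1 -> tw q g u b -> tw q g u c ->
  ~ primeOn g (fun i => (i < q + 9) || (i == b) || (i == c)).
Proof.
rewrite /outer => pg ob oc u01 tb tc pr; have u2 : u < 2 by case: u01 => ->.
pose I i := [|| i == u, i == b | i == c].
have sI i : I i -> (i < q + 9) || (i == b) || (i == c) by rewrite /I; alia.
have Iu : I u by rewrite /I eqxx.
have Ib : I b by rewrite /I eqxx orbT.
have ub : u <> b by alia.
have Y6 : (6 < q + 9) || (6 == b) || (6 == c) by alia.
have nI6 : ~~ I 6 by rewrite /I; alia.
apply: (primeOn_no_interval pr sI Iu Ib ub Y6 nI6) => v.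
suff H i : (v < q + 9) || (v == b) || (v == c) -> ~~ I v -> I i -> g v i = pth v u.
  by move=> i j Yv nv Ii Ij; rewrite !H.
rewrite /I !negb_or => Yv /and3P[/eqP vu vb vc].
have v9 : v < q + 9 by move: Yv; rewrite (negbTE vb) (negbTE vc) !orbF.
case/or3P => /eqP->.
- by rewrite (pa_path pg) //; alia.
- by rewrite (pa_sym pg) tb // pthC.
- by rewrite (pa_sym pg) tc // pthC.
Qed.

Lemma tw_inj q g u w z : u = 0 \/ u = 1 -> w = 0 \/ w = 1 -> tw q g u z -> tw q g w z -> u = w.
Proof.
by move=> [->|->] [->|->] // h1 h2; move: (h1 2) (h2 2); rewrite /pth; lia.
Qed.

Lemma tw_not_iso q g u z : u = 0 \/ u = 1 -> tw q g u z -> ~ const_on q g false z.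
Proof.
by move=> [->|->] h1 h2; [move: (h1 1) (h2 1)|move: (h1 2) (h2 2)]; rewrite /pth; lia.
Qed.

(** The value [false] out of range keeps the relation symmetric and irreflexive on all naturals. *)
Definition nat_rel n (H : sgraph 'I_n) : rel nat := fun i j =>
  if (insub i, insub j) is (Some x, Some y) then H x y else false.

Lemma nat_relE n (H : sgraph 'I_n) (x y : 'I_n) : H x y = nat_rel H x y.
Proof. by rewrite /nat_rel !valK. Qed.

Lemma nat_rel_sym n (H : sgraph 'I_n) : symmetric (nat_rel H).
Proof.
by move=> i j; rewrite /nat_rel; case: insub => [x|]; case: insub => [y|] //; apply: adj_sym.
Qed.

Lemma nat_rel_irr n (H : sgraph 'I_n) : irreflexive (nat_rel H).
Proof. by move=> i; rewrite /nat_rel; case: insub => [x|] //; apply: adj_irr. Qed.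

(** * Dictionary between a graph on ordinals and a relation on naturals *)

Section Translation.
Variables (q : nat) (H : sgraph 'I_(q + 12)) (g : rel nat).
Hypothesis HE : forall x y : 'I_(q + 12), H x y = g x y.
Hypotheses (sg : symmetric g) (ig : irreflexive g).

Lemma induced_primeOn (Z : {set 'I_(q + 12)}) (Y : pred nat) :
  (forall x : 'I_(q + 12), (x \in Z) = Y x) -> (forall i, Y i -> i < q + 12) ->
  (indecomposable (induced H Z) <-> primeOn g Y).
Proof.
move=> ZY Yn; apply: (indecomposable_primeOn (r := fun x : {x | x \in Z} => val (val x))).
- by move=> x y /val_inj/val_inj.
- by move=> x y; rewrite -HE.
- by move=> x; rewrite -ZY; apply: valP.
- move=> i Yi; have Zi : Ordinal (Yn i Yi) \in Z by rewrite ZY.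
  by exists (Sub (Ordinal (Yn i Yi)) Zi); rewrite SubK.
Qed.

Variable n_ge12 : 12 <= q + 12.
Let v := vtx n_ge12.

Lemma vtx_val k i : k = i.+1 -> i < q + 12 -> v k = i :> nat.
Proof.
move=> -> i12; have := @vtxK _ n_ge12 i.+1; rewrite -/v => h.
by have := h i12; case.
Qed.

Let v1 : v 1 = 0 :> nat. Proof. by apply: vtx_val; lia. Qed.
Let v2 : v 2 = 1 :> nat. Proof. by apply: vtx_val; lia. Qed.
Let v8 : v (q + 12 - 3) = q + 8 :> nat. Proof. by apply: vtx_val; lia. Qed.
Let v9 : v (q + 12 - 2) = q + 9 :> nat. Proof. by apply: vtx_val; lia. Qed.
Let v10 : v (q + 12 - 1) = q + 10 :> nat. Proof. by apply: vtx_val; lia. Qed.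
Let v11 : v (q + 12) = q + 11 :> nat. Proof. by apply: vtx_val; lia. Qed.

Let eq_ord (x y : 'I_(q + 12)) : (x == y) = (x == y :> nat). Proof. by []. Qed.

Lemma induced_eq_pathP (Y : {set 'I_(q + 12)}) :
  (forall x : 'I_(q + 12), (x \in Y) = (x < q + 9)) ->
  induced_eq_path H Y (q + 12 - 3) <->
  forall i j, i < q + 9 -> j < q + 9 -> g i j = pth i j.
Proof.
move=> YE; have e3 : q + 12 - 3 = q + 9 by lia.
have {YE} -> : Y = initial (q + 12) (q + 9) by apply/setP => x; rewrite YE inE.
rewrite e3; split=> [[_ h] i j i9 j9|h].
  have i12 : i < q + 12 by lia.
  have j12 : j < q + 12 by lia.
  have := h (Ordinal i12) (Ordinal j12) (Ordinal i9) (Ordinal j9) erefl erefl.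
  by rewrite HE.
by split=> // x y i j xi yj; rewrite HE xi yj h.
Qed.

Lemma in_P3_conditions :
  [/\ indecomposable H, covered (indec_graph H) [set v 1; v (q + 12 - 3)] &
      induced_eq_path H (~: [set v (q + 12); v (q + 12 - 1); v (q + 12 - 2)]) (q + 12 - 3)]
  <-> frame q g.
Proof.
have ip : indecomposable H <-> primeOn g (fun i => i < q + 12).
  apply: (indecomposable_primeOn (r := val)).
  - exact: val_inj.
  - by move=> x y; rewrite HE.
  - by move=> x; apply: ltn_ord.
  - by move=> i i12; exists (Ordinal i12).
have dp (x y : 'I_(q + 12)) : indecomposable (delete H [set x; y]) <->
    primeOn g (fun i => [&& i < q + 12, i != x & i != y]).
  apply: induced_primeOn => [z|i /and3P[]//].
  by rewrite !inE negb_or !eq_ord ltn_ord.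
have cv (x : 'I_(q + 12)) : (x \in [set v 1; v (q + 12 - 3)]) = (x == 0 :> nat) || (x == q + 8 :> nat).
  by rewrite !inE !eq_ord v1 v8.
have pp : induced_eq_path H (~: [set v (q + 12); v (q + 12 - 1); v (q + 12 - 2)]) (q + 12 - 3) <->
    forall i j, i < q + 9 -> j < q + 9 -> g i j = pth i j.
  apply: induced_eq_pathP => x; rewrite !inE !eq_ord v9 v10 v11; have := ltn_ord x; lia.
split=> [[/ip h1 h2 /pp h3]|[_ _ /pp h3 /ip h1 h2]].
- split=> //.
  move=> x y x12 y12 xy x0 x8 y0 y8 pr.
  have := h2 (Ordinal x12) (Ordinal y12); rewrite /= /indec_rel.
  have -> : indecomposable (delete H [set Ordinal x12; Ordinal y12]) by apply/dp.
  rewrite eq_ord /= andbT !cv /=; lia.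
- split=> // x y /= /andP[]; rewrite eq_ord => /eqP xy /dp pr; rewrite !cv.
  apply/negPn/negP; rewrite !negb_or => /andP[/andP[/eqP x0 /eqP x8] /andP[/eqP y0 /eqP y8]].
  exact: (h2 x y (ltn_ord x) (ltn_ord y) xy x0 x8 y0 y8 pr).
Qed.

Let X := initial (q + 12) (q + 12 - 3).
Let a := v (q + 12 - 2).
Let b := v (q + 12 - 1).
Let c := v (q + 12).

Let XE (x : 'I_(q + 12)) : (x \in X) = (x < q + 9).
Proof. by rewrite inE; have -> : q + 12 - 3 = q + 9 by lia. Qed.

Let oabc : outers q a b c.
Proof. by rewrite /a /b /c v9 v10 v11 /outers /outer; split; [lia..|split; lia]. Qed.

Let outE (x : 'I_(q + 12)) : (x \in ~: X) = outer q x.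
Proof. by rewrite inE XE /outer ltn_ord andbT -leqNgt. Qed.

Let outP (x : 'I_(q + 12)) : outer q x -> [\/ x = a, x = b | x = c].
Proof.
rewrite /outer => ox; have [|[|]] : x = q + 9 :> nat \/ x = q + 10 :> nat \/ x = q + 11 :> nat by lia.
- by rewrite -v9 => /val_inj; constructor 1.
- by rewrite -v10 => /val_inj; constructor 2.
- by rewrite -v11 => /val_inj; constructor 3.
Qed.

Lemma isolated_fromE (x : 'I_(q + 12)) : outer q x ->
  x \in isolated_from H X <-> const_on q g false x.
Proof.
move=> ox; rewrite inE outE ox /=; split=> [/forall_inP h i i9|h].
  have i12 : i < q + 12 by lia.
  have := h (Ordinal i12); rewrite XE HE => /(_ i9); exact: negbTE.
by apply/forall_inP => y; rewrite XE HE => /h->.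
Qed.

Lemma twins_ofE (u x : 'I_(q + 12)) : u < q + 9 ->
  x \in twins_of H X u <-> outer q x /\ forall i, i < q + 9 -> i <> u -> g i u = g i x.
Proof.
move=> u9; rewrite inE outE.
have uX : u \in x |: X by rewrite in_setU1 XE u9 orbT.
have xX : x \in x |: X by rewrite setU11.
split=> [/andP[ox /intervalP h]|[ox h]].
- split=> // i i9 iu; have i12 : i < q + 12 by lia.
  have iX : Ordinal i12 \in x |: X by rewrite in_setU1 XE i9 orbT.
  have := h (exist (fun y => y \in x |: X) _ iX) (exist (fun y => y \in x |: X) _ uX)
    (exist (fun y => y \in x |: X) _ xX).
  rewrite !inE /= !eqxx orbT /= /induced_rel /= !HE; apply=> //.
  by rewrite negb_or !eq_ord /=; move: ox; rewrite /outer; lia.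
- rewrite ox; apply/intervalP => w s t; rewrite !inE /= /induced_rel negb_or.
  move=> /andP[wu wx] hs ht; rewrite !HE.
  have w9 : val w < q + 9.
    by have := valP w; rewrite in_setU1 (negbTE wx) /= XE.
  have wu' : val w <> u :> nat by apply/eqP; rewrite -eq_ord.
  have E (y : {y | y \in x |: X}) : (val y == u) || (val y == x) -> g (val w) (val y) = g (val w) u.
    by case/orP => /eqP-> //; rewrite h.
  by rewrite (E s hs) (E t ht).
Qed.

Definition edge_test (e : {set 'I_(q + 12)}) := indecomposable (induced H (X :|: e)).

Lemma edge_testE (x y : 'I_(q + 12)) :
  edge_test [set x; y] <-> primeOn g (fun i => (i < q + 9) || (i == x) || (i == y)).
Proof.
apply: induced_primeOn => [z|i /orP[/orP[|/eqP->]|/eqP->]]; [|by lia|exact: ltn_ord..].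
by rewrite in_setU XE in_set2 !eq_ord orbA.
Qed.

(** All candidates for an edge of G_X. Listing them turns the number of edges into a sum of three
    booleans. *)
Definition outer_pairs := [:: [set a; b]; [set a; c]; [set b; c]].

Lemma outer_pairs_uniq : uniq outer_pairs.
Proof.
case: oabc => _ _ _ [ab ac bc].
have ab' : (a == b) = false by apply/eqP => e; case: ab; rewrite e.
have ac' : (a == c) = false by apply/eqP => e; case: ac; rewrite e.
have bc' : (b == c) = false by apply/eqP => e; case: bc; rewrite e.
rewrite /outer_pairs /= !inE negb_or !andbT; apply/andP; split; [apply/andP; split|];
  apply/eqP => /setP e.
- by have := e b; rewrite !inE eqxx bc' eq_sym ab' orbT.
- by have := e a; rewrite !inE eqxx ab' ac'.
- by have := e a; rewrite !inE eqxx ab' ac'.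
Qed.

Lemma outside_edgesE (e : {set 'I_(q + 12)}) :
  (e \in outside_edges H X) = (e \in outer_pairs) && edge_test e.
Proof.
have [oa ob oc [ab ac bc]] := oabc.
apply/imsetP/andP => [[[x y]]|[eP te]].
  rewrite inE /= !outE => /and4P[ox oy xy te] ->; split=> //; move: xy.
  rewrite !inE; case: (outP ox) => ->; case: (outP oy) => -> //=; rewrite ?eqxx ?orbT //= => _;
  by rewrite (setUC [set _]) ?eqxx ?orbT.
have P x y : e = [set x; y] -> outer q x -> outer q y -> x <> y :> nat ->
    exists2 p, p \in [pred p : 'I_(q + 12) * 'I_(q + 12) |
      [&& p.1 \in ~: X, p.2 \in ~: X, p.1 != p.2 &
         indecomposable (induced H (X :|: [set p.1; p.2]))]] & e = [set p.1; p.2].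
  move=> ee ox oy xy; exists (x, y) => //=; rewrite inE /= !outE ox oy /=.
  by apply/andP; split; [apply/eqP => exy; case: xy; rewrite exy|rewrite -ee].
move: eP; rewrite !inE => /or3P[] /eqP ee.
- by have [p hp ->] := P a b ee oa ob ab; exists p => //; rewrite inE; exact: hp.
- by have [p hp ->] := P a c ee oa oc ac; exists p => //; rewrite inE; exact: hp.
- by have [p hp ->] := P b c ee ob oc bc; exists p => //; rewrite inE; exact: hp.
Qed.

Lemma card_outside_edges :
  #|outside_edges H X| = edge_test [set a; b] + edge_test [set a; c] + edge_test [set b; c].
Proof.
have -> : #|outside_edges H X| = #|[seq e <- outer_pairs | edge_test e]|.
  by apply: eq_card => e; rewrite outside_edgesE mem_filter andbC.
rewrite (card_uniqP (filter_uniq _ outer_pairs_uniq)) size_filter /= addn0 addnA.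
by [].
Qed.

Lemma outside_edges_single (e : {set 'I_(q + 12)}) : e \in outer_pairs ->
  outside_edges H X = [set e] <-> forall e', e' \in outer_pairs -> edge_test e' = (e' == e).
Proof.
move=> eP; split=> [E e' e'P|h].
  by have := outside_edgesE e'; rewrite e'P E inE.
apply/setP => e'; rewrite outside_edgesE in_set1; case e'P: (e' \in outer_pairs) => /=; first exact: h.
by apply/esym/negP => /eqP ee; rewrite ee eP in e'P.
Qed.

Lemma outer_pairs_neq :
  [/\ [set a; b] != [set a; c], [set a; b] != [set b; c] & [set a; c] != [set b; c]].
Proof.
by have := outer_pairs_uniq; rewrite /= !inE negb_or => /andP[/andP[-> ->]] /andP[-> _].
Qed.

Lemma sim2E (x y z : 'I_(q + 12)) : sim H x [set y; z] = (g y x == g z x).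
Proof.
rewrite (sg y) (sg z) -!HE; apply/simP/eqP => [h|h i j]; first by apply: h; rewrite !inE eqxx ?orbT.
by rewrite !inE => /orP[] /eqP-> /orP[] /eqP->.
Qed.

Section Assertions.
Hypothesis pg : pathed q g.

Let u01_lt u : u = 0 \/ u = 1 -> u < q + 9. Proof. by case=> ->; lia. Qed.

Lemma twins_of_tw k (u x : 'I_(q + 12)) : k = 0 \/ k = 1 -> u = k :> nat ->
  x \in twins_of H X u <-> outer q x /\ tw q g k x.
Proof.
move=> k01 uk; have k9 := u01_lt k01; have u9 : u < q + 9 by rewrite uk.
rewrite (twins_ofE _ u9) uk; split=> -[ox h]; split=> // i i9 iu.
  by rewrite sg -h // (pa_path pg) // pthC.
by rewrite (pa_path pg) // sg h // pthC.
Qed.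

Lemma twins_of_set k (u : 'I_(q + 12)) (S : {set 'I_(q + 12)}) : k = 0 \/ k = 1 ->
  u = k :> nat -> (forall x, x \in S -> outer q x /\ tw q g k x) ->
  (forall x : 'I_(q + 12), outer q x -> x \notin S -> ~ tw q g k x) -> twins_of H X u = S.
Proof.
move=> k01 uk h1 h2; apply/setP => x; apply/idP/idP.
  by move=> /(twins_of_tw _ k01 uk)[ox tx]; apply/negPn/negP => /(h2 x ox).
by move/h1/(twins_of_tw _ k01 uk).
Qed.

Lemma tw_of_twins k (u x : 'I_(q + 12)) (S : {set 'I_(q + 12)}) : k = 0 \/ k = 1 ->
  u = k :> nat -> twins_of H X u = S -> x \in S -> tw q g k x.
Proof. by move=> k01 uk <- /(twins_of_tw _ k01 uk)[]. Qed.

Lemma edge_test_iso_tw u (x : 'I_(q + 12)) : outer q x -> a <> x :> nat -> u = 0 \/ u = 1 ->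
  const_on q g false a -> tw q g u x -> edge_test [set a; x] = g a x.
Proof.
move=> ox ax u01 ca tx; have [oa _ _ _] := oabc.
by apply/idP/idP => [/edge_testE|h]; [|apply/edge_testE];
  have [h1 h2] := primeOn_iso_tw pg oa ox ax u01 ca tx; auto.
Qed.

Lemma edge_test_first_second : tw q g 1 b -> tw q g 0 c -> edge_test [set b; c] = ~~ g b c.
Proof.
move=> tb tc; have [_ ob oc [_ _ bc]] := oabc.
by apply/idP/idP => [/edge_testE|h]; [|apply/edge_testE];
  have [h1 h2] := primeOn_first_second pg ob oc bc tb tc; auto.
Qed.

Lemma edge_test_iso : const_on q g false a -> const_on q g false b -> edge_test [set a; b] = false.
Proof.
move=> ca cb; have [oa _ _ _] := oabc.
by apply/negP => /edge_testE; apply: not_primeOn_iso.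
Qed.

Lemma edge_test_tw u : u = 0 \/ u = 1 -> tw q g u b -> tw q g u c -> edge_test [set b; c] = false.
Proof.
move=> u01 tb tc; have [_ ob oc _] := oabc.
by apply/negP => /edge_testE; apply: (not_primeOn_tw pg ob oc u01).
Qed.

Hypothesis ca : const_on q g false a.

Let o2 := let: And4 oa ob oc (And3 ab ac bc) := oabc in ob.
Let o3 := let: And4 oa ob oc (And3 ab ac bc) := oabc in oc.
Let n12 := let: And4 oa ob oc (And3 ab ac bc) := oabc in ab.
Let n13 := let: And4 oa ob oc (And3 ab ac bc) := oabc in ac.
Let n23 := let: And4 oa ob oc (And3 ab ac bc) := oabc in bc.
Let l0 : 0 = 0 \/ 0 = 1. Proof. by left. Qed.
Let l1 : 1 = 0 \/ 1 = 1. Proof. by right. Qed.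

Lemma assertion_iP : assertion_i n_ge12 H <-> cfg_i q g a b c.
Proof.
have [p1 p2 p3] := outer_pairs_neq.
have abP : [set a; b] \in outer_pairs by rewrite !inE eqxx.
have acP : [set a; c] \in outer_pairs by rewrite !inE eqxx orbT.
have bcP : [set b; c] \in outer_pairs by rewrite !inE eqxx !orbT.
rewrite /assertion_i -/v -/X -/a -/b -/c HE (sg b a) (setUC [set c] [set b]); split.
- move=> [/(isolated_fromE o2) cb tE] /(outside_edges_single bcP) E ab.
  have tc : tw q g 0 c by apply: (tw_of_twins l0 v1 tE); rewrite inE.
  split=> //; split=> //.
    have := E _ bcP; rewrite eqxx => /edge_testE; exact: (primeOn_iso_tw pg o2 o3 n23 l0 cb tc).1.
  by rewrite -(edge_test_iso_tw o3 n13 l0 ca tc) (E _ acP).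
- move=> [_ cb tc [bc ac ab]]; split=> //; first exact/(isolated_fromE o2).
    apply: (twins_of_set l0 v1) => [x|x ox]; first by rewrite inE => /eqP->.
    by rewrite inE; case: (outP ox) => -> => [_|_|]; [move/(tw_not_iso l0)|move/(tw_not_iso l0)|rewrite eqxx].
  apply/(outside_edges_single bcP) => e; rewrite !inE => /or3P[] /eqP->.
  + by rewrite (negbTE p2) edge_test_iso.
  + by rewrite (negbTE p3) (edge_test_iso_tw o3 n13 l0 ca tc) (negbTE ac).
  + rewrite eqxx; apply/edge_testE; exact: (primeOn_iso_tw pg o2 o3 n23 l0 cb tc).2.
Qed.

Lemma assertion_iiP : assertion_ii n_ge12 H <-> cfg_ii q g a b c.
Proof.
have bcP : [set b; c] \in outer_pairs by rewrite !inE eqxx !orbT.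
rewrite /assertion_ii -/v -/X -/a -/b -/c card_outside_edges HE (setUC [set c] [set b]).
rewrite outside_edgesE bcP v1 (sg 0 c); split.
- move=> [t1 t0 E n0].
  have tb : tw q g 1 b by apply: (tw_of_twins l1 v2 t1); rewrite inE.
  have tc : tw q g 0 c by apply: (tw_of_twins l0 v1 t0); rewrite inE.
  move: E n0; rewrite edge_test_first_second // (edge_test_iso_tw o2 n12 l1 ca tb).
  rewrite (edge_test_iso_tw o3 n13 l0 ca tc) => E n0; split=> //.
    by move: E; case: (g a b); case: (g a c); case: (g b c).
  by move/n0/negbTE.
- move=> [_ tb tc E n0].
  rewrite edge_test_first_second // (edge_test_iso_tw o2 n12 l1 ca tb).
  rewrite (edge_test_iso_tw o3 n13 l0 ca tc); split.
  + apply: (twins_of_set l1 v2) => [x|x ox]; first by rewrite inE => /eqP->.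
    rewrite inE; case: (outP ox) => -> nx.
    * by move/(tw_not_iso l1).
    * by rewrite eqxx in nx.
    * by move/(tw_inj l0 l1 tc).
  + apply: (twins_of_set l0 v1) => [x|x ox]; first by rewrite inE => /eqP->.
    rewrite inE; case: (outP ox) => -> nx.
    * by move/(tw_not_iso l0).
    * by move/(tw_inj l1 l0 tb).
    * by rewrite eqxx in nx.
  + by move: E; case: (g a b); case: (g a c); case: (g b c).
  + by move/n0 => ->.
Qed.

Lemma assertion_iiiP : assertion_iii n_ge12 H <-> cfg_iii q g a b c.
Proof.
have [p1 p2 p3] := outer_pairs_neq.
have abP : [set a; b] \in outer_pairs by rewrite !inE eqxx.
have acP : [set a; c] \in outer_pairs by rewrite !inE eqxx orbT.
(* Two twins of the same vertex are never an edge of G_X, so two edges means that [a] is adjacent to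
   both [b] and [c]. *)
have uE (u : 'I_(q + 12)) k : k = 0 \/ k = 1 -> u = k :> nat -> tw q g k b -> tw q g k c ->
    (#|outside_edges H X| = 2 /\ ~~ sim H u [set b; c]) \/
    (outside_edges H X = [set [set c; a]] /\ ~~ sim H c [set b; u]) <->
    [&& g a b, g a c & g b k != g c k] || [&& ~~ g a b, g a c & g c b != g c k].
  move=> k01 uk tb tc.
  have e1 := edge_test_iso_tw o2 n12 k01 ca tb; have e2 := edge_test_iso_tw o3 n13 k01 ca tc.
  have e3 := edge_test_tw k01 tb tc.
  rewrite !sim2E card_outside_edges (setUC [set c]) e1 e2 e3 uk (sg b c) (sg k c) addn0.
  split=> [[[E ->]|[/(outside_edges_single acP) E ->]]|].
  - by move: E; case: (g a b); case: (g a c).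
  - by rewrite -e1 -e2 !E // eqxx (negbTE p1).
  - case/orP => /and3P[h1 h2 ->]; [left|right]; split=> //; first by rewrite h1 h2.
    apply/(outside_edges_single acP) => e; rewrite !inE => /or3P[] /eqP->.
    + by rewrite e1 (negbTE p1) (negbTE h1).
    + by rewrite e2 eqxx.
    + by rewrite e3 eq_sym (negbTE p3).
rewrite /assertion_iii -/v -/X -/a -/b -/c; split=> [[u [u12 tE E]]|[k [k01 _ tb tc E]]].
- have [k [k01 uk]] : exists k, (k = 0 \/ k = 1) /\ u = k :> nat.
    by case: u12 => ->; [exists 0|exists 1]; rewrite ?v1 ?v2; auto.
  have tb : tw q g k b by apply: (tw_of_twins k01 uk tE); rewrite !inE eqxx.
  have tc : tw q g k c by apply: (tw_of_twins k01 uk tE); rewrite !inE eqxx orbT.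
  by exists k; split=> //; apply/(uE u k).
- have [u [uk u12]] : exists u : 'I_(q + 12), u = k :> nat /\ (u = v 1 \/ u = v 2).
    by case: k01 => ->; [exists (v 1)|exists (v 2)]; auto.
  exists u; split=> //; last by apply/(uE u k).
  apply: (twins_of_set k01 uk) => [x|x ox].
    by rewrite !inE => /orP[] /eqP->.
  rewrite !inE; case: (outP ox) => ->; rewrite ?eqxx ?orbT // => _.
  by move/(tw_not_iso k01).
Qed.

(** The types of [b] and [c] tell the three configurations apart, so that exactly one holds as soon
    as one of them does. *)
Lemma cfg_exclusive : [/\ ~ (cfg_i q g a b c /\ cfg_ii q g a b c),
  ~ (cfg_i q g a b c /\ cfg_iii q g a b c) & ~ (cfg_ii q g a b c /\ cfg_iii q g a b c)].
Proof.
split.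
- by move=> [[_ cb _ _] [_ tb _ _ _]]; apply: (tw_not_iso l1 tb cb).
- by move=> [[_ cb _ _] [u [u01 _ tb _ _]]]; apply: (tw_not_iso u01 tb cb).
- move=> [[_ tb tc _ _] [u [u01 _ tb' tc' _]]].
  have e1 := tw_inj u01 l1 tb' tb; have e0 := tw_inj u01 l0 tc' tc.
  by rewrite e0 in e1.
Qed.

Lemma exactly_oneP :
  exactly_one (assertion_i n_ge12 H) (assertion_ii n_ge12 H) (assertion_iii n_ge12 H) <->
  cfg q g a b c.
Proof.
have [x1 x2 x3] := cfg_exclusive.
have [i1 i2] := assertion_iP; have [j1 j2] := assertion_iiP; have [k1 k2] := assertion_iiiP.
split=> [[[/i1 h _ _]|[_ /j1 h _]|[_ _ /k1 h]]|[h|h|h]].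
- by constructor 1.
- by constructor 2.
- by constructor 3.
- by constructor 1; split=> [|/j1 ?|/k1 ?]; auto.
- by constructor 2; split=> [/i1 ?||/k1 ?]; auto.
- by constructor 3; split=> [/i1 ?|/j1 ?|]; auto.
Qed.

End Assertions.

Lemma in_G_conditions :
  [/\ induced_eq_path H X (q + 12 - 3), a \in isolated_from H X &
      exactly_one (assertion_i n_ge12 H) (assertion_ii n_ge12 H) (assertion_iii n_ge12 H)] <->
  pathed q g /\ cfg q g a b c.
Proof.
have oa : outer q a by case: oabc.
have [h1 h2] := induced_eq_pathP XE; have [k1 k2] := isolated_fromE oa.
split=> [[/h1 P /k1 ca ex]|[pg c0]].
  by have pg : pathed q g by []; split=> //; apply/exactly_oneP.
have ca : const_on q g false a by case: c0 => [[]|[]|[? []]].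
by split; [apply: h2; apply: pa_path|apply: k2|apply/exactly_oneP].
Qed.

End Translation.

Lemma in_P3_frame q (H : sgraph 'I_(q + 12)) (g : rel nat) :
  (forall x y : 'I_(q + 12), H x y = g x y) -> symmetric g -> irreflexive g ->
  in_P3 H <-> frame q g.
Proof.
move=> HE sg ig; split=> [[n12 /(in_P3_conditions HE sg ig)//]|fr].
have n12 : 12 <= q + 12 by lia.
by exists n12; apply/(in_P3_conditions HE sg ig).
Qed.

Lemma in_G_cfg q (H : sgraph 'I_(q + 12)) (g : rel nat) :
  (forall x y : 'I_(q + 12), H x y = g x y) -> symmetric g -> irreflexive g ->
  in_G H <-> pathed q g /\ cfg q g (q + 9) (q + 10) (q + 11).
Proof.
move=> HE sg ig.
have vE (n12 : 12 <= q + 12) : [/\ vtx n12 (q + 12 - 2) = q + 9 :> nat, vtx n12 (q + 12 - 1) = q + 10 :> nat &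
    vtx n12 (q + 12) = q + 11 :> nat] by split; apply: vtx_val; lia.
split=> [[n12 /(in_G_conditions HE sg ig)]|h].
  by have [-> -> ->] := vE n12.
have n12 : 12 <= q + 12 by lia.
exists n12; apply/(in_G_conditions HE sg ig).
by have [-> -> ->] := vE n12.
Qed.

Definition graph_of n (g : rel nat) (sg : symmetric g) (ig : irreflexive g) : sgraph 'I_n :=
  @SGraph _ (fun x y : 'I_n => g x y) (fun x y => sg x y) (fun x => ig x).

Theorem proposition4p4 (V : finType) (G : sgraph V) :
  (exists (n : nat) (H : sgraph 'I_n), in_P3 H /\ isomorphic G H) <->
  (exists (n : nat) (H : sgraph 'I_n),
     [/\ in_G H, 12 <= #|'I_n| & isomorphic G H]).
Proof.
split=> [[n [H [hP iso]]]|[n [H [hG _ iso]]]]; have n12 : 12 <= n.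
- by case: hP.
- have [q e] : exists q, n = q + 12 by exists (n - 12); lia.
  subst n; set g := nat_rel H; have [sg ig] := (@nat_rel_sym _ H, @nat_rel_irr _ H).
  have /frame_good[s [t [sK tK sn sp cs]]] : frame q g.
    exact: (in_P3_frame (@nat_relE _ H) sg ig).1.
  have sgs : symmetric (relabel s g) by move=> i j; apply: sg.
  have igs : irreflexive (relabel s g) by move=> i; apply: ig.
  have tn i : i < q + 12 -> t i < q + 12 by move=> i12; rewrite -sn tK.
  have sn' i : i < q + 12 -> s i < q + 12 by rewrite sn.
  exists (q + 12), (graph_of (q + 12) sgs igs); split.
  + by apply/(in_G_cfg (g := relabel s g)).
  + by rewrite card_ord.
  + case: iso => f [f' fK f'K] fE.
    (* The relabelled graph evaluates [g] after [s], so the given isomorphism is composed with the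
       inverse [t]. *)
    exists (fun x => Ordinal (tn _ (ltn_ord (f x)))).
      exists (fun y => f' (Ordinal (sn' _ (ltn_ord y)))).
        by move=> x; rewrite -[RHS]fK; congr f'; apply: val_inj; rewrite /= tK.
      by move=> y; apply: val_inj; rewrite /= f'K /= sK.
    by move=> x y; rewrite /= /relabel !tK /g -nat_relE fE.
- by case: hG.
- have [q e] : exists q, n = q + 12 by exists (n - 12); lia.
  subst n; exists (q + 12), H; split=> //.
  apply/(in_P3_frame (@nat_relE _ H) (@nat_rel_sym _ H) (@nat_rel_irr _ H)).
  have [pg c0] := (in_G_cfg (@nat_relE _ H) (@nat_rel_sym _ H) (@nat_rel_irr _ H)).1 hG.
  have o : outers q (q + 9) (q + 10) (q + 11) by rewrite /outers /outer; split; [lia..|split; lia].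
  exact: (cfg_frame pg o c0).
Qed.
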